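(* Let $\beta>0$, $\lambda\in\mathbb R$, and let $\bar q\in\mathcal D_{\beta,\lambda}:=\{\bar q\ge0:\ 1-\lambda+\beta^2\bar q>0\}$. Set $\sigma=(1-\lambda+\beta^2\bar q)^{-1/2}$ and $$\tilde A(\beta,\lambda,\bar q)=\log\sigma+\frac12\beta^2\bar q\sigma^2+\frac{\beta^2}{4}\bar q^2.$$ Then for every $N\ge1$ $$A_N(\beta,\lambda)=\tilde A(\beta,\lambda,\bar q)-\frac{\beta^2}{4}\int_0^1\big\langle (q_{12}-\bar q)^2\big\rangle_t\,dt,$$ and consequently $A_N(\beta,\lambda)\le\tilde A(\beta,\lambda,\bar q)$ uniformly in $N$.
   Context: For $N\ge 1$, $\beta>0$, $\lambda\in\mathbb{R}$, let $J=(J_{ij})_{i,j=1}^N$ be $N^2$ i.i.d. standard Gaussian $\mathcal N(0,1)$ random variables (one for each ordered pair $(i,j)$, diagonal pairs included). $\mathbb E_z$ denotes integration with respect to the standard Gaussian measure $(2\pi)^{-N/2}e^{-\|z\|^2/2}dz$ on $\mathbb R^N$, and $\mathbb E$ denotes expectation with respect to all the Gaussian disorder variables. The (zero-field) partition function is $$Z_N(\beta,\lambda;J)=\mathbb E_z\exp\Big(\frac{\beta}{\sqrt{2N}}\sum_{i,j=1}^N J_{ij}z_iz_j-\frac{\beta^2}{4N}\Big(\sum_{i=1}^N z_i^2\Big)^2+\frac{\lambda}{2}\sum_{i=1}^N z_i^2\Big),$$ and $A_N(\beta,\lambda)=\frac1N\mathbb E\log Z_N(\beta,\lambda;J)$.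 RS interpolation: let $(J'_i)_{i=1}^N$ be i.i.d. $\mathcal N(0,1)$, independent of $J$; fix $\bar q\in\mathcal D_{\beta,\lambda}$ and $c=-\beta^2\bar q$. For $t\in[0,1]$ the interpolating Gibbs weight is $$\exp\Big(\beta\sqrt{\tfrac{t}{2N}}\sum_{i,j=1}^NJ_{ij}z_iz_j-\tfrac{t\beta^2}{4N}\big(\textstyle\sum_i z_i^2\big)^2+\beta\sqrt{1-t}\sqrt{\bar q}\sum_iJ'_iz_i+\tfrac{(1-t)c}{2}\sum_i z_i^2+\tfrac\lambda2\sum_iz_i^2\Big)$$ with respect to the standard Gaussian measure on $\mathbb R^N$; $\omega_t$ is the associated Gibbs probability measure, and for a function $F$ of two replicas $z^{(1)},z^{(2)}$, $\langle F\rangle_t=\mathbb E[(\omega_t\otimes\omega_t)(F)]$, with $\mathbb E$ over $J$ and $J'$. The overlap is $q_{12}=\frac1N\sum_{i=1}^N z^{(1)}_iz^{(2)}_i$. *)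

(* Defs.v *)
From mathcomp Require Import all_boot all_order all_algebra.
From mathcomp Require Import all_classical all_reals all_analysis.
Set Implicit Arguments. Unset Strict Implicit. Unset Printing Implicit Defensive.
Import Order.TTheory GRing.Theory Num.Theory.
Import numFieldNormedType.Exports.
Local Open Scope classical_set_scope.
Local Open Scope ring_scope.

Section SK.
Variable R : realType.

Definition gdens (x : R) : R := (Num.sqrt (2 * pi))^-1 * expR (- (x ^+ 2) / 2).

(* Integral of f against the standard Gaussian measure on R^n, where a point
   of R^n is the list [:: x_0; ...; x_{n-1}] (coordinate i is  nth 0 s i).
   It is given as the iterated (Lebesgue) integral of the product density. *)
Fixpoint gexp (n : nat) (f : seq R -> R) : R :=
  match n with
  | 0 => f [::]
  | n'.+1 => \int[@lebesgue_measure R]_(x in [set: R])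
               (gdens x * gexp n' (fun s => f (x :: s)))
  end.

Definition zc (z : seq R) (i : nat) : R := nth 0 z i.
Definition Jc (N : nat) (J : seq R) (i j : nat) : R := nth 0 J (i * N + j).

Definition sumsq (N : nat) (z : seq R) : R := \sum_(i < N) zc z i ^+ 2.
Definition Hquad (N : nat) (J z : seq R) : R :=
  \sum_(i < N) \sum_(j < N) Jc N J i j * zc z i * zc z j.

Definition ZN (N : nat) (beta lam : R) (J : seq R) : R :=
  gexp N (fun z => expR (beta / Num.sqrt (2 * N%:R) * Hquad N J z
                         - beta ^+ 2 / (4 * N%:R) * (sumsq N z) ^+ 2
                         + lam / 2 * sumsq N z)).

Definition AN (N : nat) (beta lam : R) : R :=
  N%:R^-1 * gexp (N * N) (fun J => ln (ZN N beta lam J)).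

(* RS interpolation weight, c = - beta^2 qbar *)
Definition wt (N : nat) (beta lam qbar t : R) (J J' z : seq R) : R :=
  let c := - (beta ^+ 2 * qbar) in
  expR (beta * Num.sqrt (t / (2 * N%:R)) * Hquad N J z
        - t * beta ^+ 2 / (4 * N%:R) * (sumsq N z) ^+ 2
        + beta * Num.sqrt (1 - t) * Num.sqrt qbar * (\sum_(i < N) zc J' i * zc z i)
        + (1 - t) * c / 2 * sumsq N z
        + lam / 2 * sumsq N z).

Definition gibbs2 (N : nat) (beta lam qbar t : R) (J J' : seq R)
    (F : seq R -> seq R -> R) : R :=
  gexp N (fun z1 => gexp N (fun z2 =>
     F z1 z2 * wt N beta lam qbar t J J' z1 * wt N beta lam qbar t J J' z2))
  / (gexp N (fun z => wt N beta lam qbar t J J' z)) ^+ 2.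

Definition bracket (N : nat) (beta lam qbar t : R) (F : seq R -> seq R -> R) : R :=
  gexp (N * N) (fun J => gexp N (fun J' => gibbs2 N beta lam qbar t J J' F)).

Definition overlap (N : nat) (z1 z2 : seq R) : R :=
  N%:R^-1 * \sum_(i < N) zc z1 i * zc z2 i.

Definition inD (beta lam qbar : R) : Prop := 0 <= qbar /\ 0 < 1 - lam + beta ^+ 2 * qbar.

Definition sigmaRS (beta lam qbar : R) : R := (Num.sqrt (1 - lam + beta ^+ 2 * qbar))^-1.

Definition Atilde (beta lam qbar : R) : R :=
  ln (sigmaRS beta lam qbar) + 1 / 2 * beta ^+ 2 * qbar * (sigmaRS beta lam qbar) ^+ 2
  + beta ^+ 2 / 4 * qbar ^+ 2.

End SK.

(* Main.v *)
Require Import Defs.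
From mathcomp Require Import all_boot all_order all_algebra.
From mathcomp Require Import all_classical all_reals all_analysis.
From mathcomp Require Import measurable_realfun ring lra.
Import Order.TTheory GRing.Theory Num.Theory.
Import numFieldNormedType.Exports.
Local Open Scope classical_set_scope.
Local Open Scope ring_scope.

(** Guerra interpolation. Write t = sin^2 theta, so that the interpolating Hamiltonian is smooth in
    theta: a sum of c_k(theta) g_k phi_k(z) over the Gaussian disorder g = (J, J') and of a deterministic
    potential. Differentiating E log Z and integrating by parts in each g_k produces
    c_k c_k' E (omega(phi_k^2) - omega(phi_k)^2); the potential is chosen so that the one-replica
    terms cancel, and what remains of the two-replica terms completes to the square
    (q_12 - qbar)^2. At t = 0 the integral over z factorizes into one-dimensional Gaussians.

    All exchanges of limits are justified by domination by K exp(d |z|^2) with d < 1/2. Uniformity in t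
    down to 0, where the quartic confinement disappears, comes from completing the square: the
    quadratic form sqrt t J is absorbed by the quartic term at the price of a factor exp(|J|^2),
    which is harmless because only log Z and Gibbs averages are integrated over J. Gibbs moments are
    then polynomially bounded in the disorder. *)

Set Implicit Arguments. Unset Strict Implicit. Unset Printing Implicit Defensive.

(** * Gaussian integrals on the line *)

(** The angle serves because the square roots of [t] and [1 - t] have unbounded derivatives at 0 and
    1, while [sin] and [cos] do not; the return to [t] is made on the open interval only, and
    continuity supplies the endpoints. The integral over R^n being iterated, integrability is
    replaced by sequential continuity plus Gaussian domination, a condition inherited by partial
    integrals, so that the analysis goes by induction on the dimension. No order of integration is
    ever exchanged: the disorder stays outside the [z] integral, and two replicas separate because
    the square of [q_12 - qbar] is a finite sum of products of one-replica functions. With [t = a^2]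
    and [1 - t = b^2], the relation [b^2 = 1 - a^2] turns the coefficient of [|z|^2] into
    [(1 - kappa) / 2] plus an excess proportional to [a^2]. The quartic confinement carries the same
    factor [a^2], hence controls the excess uniformly, and [kappa > 0], which is the condition
    defining the domain of [qbar], keeps the rest below 1/2. *)

Section GaussianLine.
Variable R : realType.
Implicit Types (x y b d K : R).
Local Notation mu := (@lebesgue_measure R).

Lemma gdens_gt0 x : 0 < gdens x.
Proof. by rewrite mulr_gt0 ?expR_gt0// invr_gt0 sqrtr_gt0 mulr_gt0 ?pi_gt0. Qed.

Lemma gdens_ge0 x : 0 <= gdens x. Proof. exact/ltW/gdens_gt0. Qed.

Lemma continuous_gdens : continuous (@gdens R).
Proof.
move=> x; apply: cvgM; first exact: cvg_cst.
apply: (cvg_comp _ expR); last exact: continuous_expR.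
apply: cvgM; last exact: cvg_cst.
by apply: cvgN; exact: sqr_continuous.
Qed.

(** Completing the square: the tilted Gaussian is a multiple of the normal density with standard
    deviation [s] and mean [b s^2], whose total mass then gives the explicit integrals against
    [gdens]. *)
Lemma gdens_expE d b x : d < 1 / 2 ->
  let s := (Num.sqrt (1 - 2 * d))^-1 in
  gdens x * expR (b * x + d * x ^+ 2) =
  s * expR (b ^+ 2 * s ^+ 2 / 2) * normal_pdf (b * s ^+ 2) s x.
Proof.
move=> d2 s; have dp : 0 < 1 - 2 * d by lra.
have sp : 0 < s by rewrite invr_gt0 sqrtr_gt0.
have s2 : s ^+ 2 = (1 - 2 * d)^-1 by rewrite exprVn sqr_sqrtr// ltW.
rewrite normal_pdfE ?gt_eqF// /gdens /normal_peak /normal_fun.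
have -> : Num.sqrt (s ^+ 2 * pi *+ 2) = s * Num.sqrt (2 * pi).
  by rewrite -mulrnAr mulr_natl sqrtrM ?sqr_ge0// sqrtr_sqr gtr0_norm.
have p0 : Num.sqrt (2 * pi) != 0 :> R by rewrite gt_eqF// sqrtr_gt0 mulr_gt0 ?pi_gt0.
have -> (A B : R) : s * A * ((s * Num.sqrt (2 * pi))^-1 * B) =
    (Num.sqrt (2 * pi))^-1 * (A * B).
  by field; rewrite p0 gt_eqF.
rewrite -[LHS]mulrA -!expRD; congr (_ * expR _).
rewrite s2 -[_ *+ 2]mulr_natr; field; lra.
Qed.

Definition gmass d := \int[mu]_x (gdens x * expR (d * x ^+ 2)).

Lemma gdens_exp_integrable d b : d < 1 / 2 ->
  mu.-integrable setT (EFin \o (fun x => gdens x * expR (b * x + d * x ^+ 2))).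
Proof.
move=> d2; rewrite (_ : _ \o _ = fun x => ((Num.sqrt (1 - 2 * d))^-1 *
   expR (b ^+ 2 * (Num.sqrt (1 - 2 * d))^-1 ^+ 2 / 2))%:E *
   (normal_pdf (b * (Num.sqrt (1 - 2 * d))^-1 ^+ 2) (Num.sqrt (1 - 2 * d))^-1 x)%:E)%E.
  by apply: integrableZl => //; exact: integrable_normal_pdf.
by apply/funext => x /=; rewrite gdens_expE.
Qed.

Lemma gdens_exp_integral d b : d < 1 / 2 ->
  let s := (Num.sqrt (1 - 2 * d))^-1 in
  \int[mu]_x (gdens x * expR (b * x + d * x ^+ 2)) = s * expR (b ^+ 2 * s ^+ 2 / 2).
Proof.
move=> d2 s; under eq_Rintegral do rewrite gdens_expE//.
rewrite RintegralZl//; last exact: integrable_normal_pdf.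
by rewrite /Rintegral integral_normal_pdf mulr1.
Qed.

Lemma gmass_integrable d K : d < 1 / 2 ->
  mu.-integrable setT (EFin \o (fun x => gdens x * (K * expR (d * x ^+ 2)))).
Proof.
move=> d2; rewrite (_ : _ \o _ =
   fun x => K%:E * (gdens x * expR (0 * x + d * x ^+ 2))%:E)%E.
  by apply: integrableZl => //; exact: gdens_exp_integrable.
by apply/funext => x /=; rewrite mul0r add0r mulrCA.
Qed.

Lemma gmassE d : d < 1 / 2 -> gmass d = (Num.sqrt (1 - 2 * d))^-1.
Proof.
move=> d2; rewrite /gmass.
under eq_Rintegral => x _ do rewrite -[d * _]add0r -[X in X + _](mul0r x).
by rewrite gdens_exp_integral// expr0n /= !mul0r expR0 mulr1.
Qed.

Lemma gmass_gt0 d : d < 1 / 2 -> 0 < gmass d.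
Proof. by move=> d2; rewrite gmassE// invr_gt0 sqrtr_gt0; lra. Qed.

Lemma gauss_measurable (f : R -> R) : continuous f ->
  measurable_fun [set: R] (fun x => gdens x * f x : R).
Proof.
move=> cf; apply: continuous_measurable_fun => x.
by apply: cvgM; [exact: continuous_gdens|exact: cf].
Qed.

Lemma gauss_le d K (f : R -> R) : (forall x, `|f x| <= K * expR (d * x ^+ 2)) ->
  forall x, `|gdens x * f x| <= gdens x * (K * expR (d * x ^+ 2)).
Proof.
by move=> fK x; rewrite normrM (ger0_norm (gdens_ge0 x)) ler_wpM2l ?gdens_ge0.
Qed.

Lemma gauss_integrable d K (f : R -> R) : d < 1 / 2 -> continuous f ->
  (forall x, `|f x| <= K * expR (d * x ^+ 2)) ->
  mu.-integrable setT (EFin \o (fun x => gdens x * f x)).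
Proof.
move=> d2 cf fK; apply: (le_integrable _ _ _ (gmass_integrable K d2)) => //.
  by apply/measurable_EFinP; apply: gauss_measurable.
move=> x _ /=; rewrite lee_fin (le_trans (gauss_le fK x))//.
exact: ler_norm.
Qed.

Lemma gauss_bound d K (f : R -> R) : d < 1 / 2 -> continuous f ->
  (forall x, `|f x| <= K * expR (d * x ^+ 2)) ->
  `|\int[mu]_x (gdens x * f x)| <= K * gmass d.
Proof.
move=> d2 cf fK; have fi := gauss_integrable d2 cf fK.
apply: (le_trans (le_normr_Rintegral _ fi)) => //.
rewrite /gmass -RintegralZl//; last first.
  rewrite (_ : _ \o _ = EFin \o (fun x => gdens x * (1 * expR (d * x ^+ 2)))).
    exact: gmass_integrable.
  by apply/funext => x /=; rewrite mul1r.
apply: le_Rintegral => //.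
- exact: (integrable_norm fi).
- rewrite (_ : _ \o _ = EFin \o (fun x => gdens x * (K * expR (d * x ^+ 2)))).
    exact: gmass_integrable.
  by apply/funext => x /=; rewrite mulrCA.
- by move=> x _; rewrite mulrCA; exact: gauss_le.
Qed.

Lemma gauss_cvg d K (f_ : nat -> R -> R) (f : R -> R) : d < 1 / 2 ->
  (forall m, continuous (f_ m)) -> continuous f ->
  (forall m x, `|f_ m x| <= K * expR (d * x ^+ 2)) ->
  (forall x, f_ m x @[m --> \oo] --> f x) ->
  \int[mu]_x (gdens x * f_ m x) @[m --> \oo] --> \int[mu]_x (gdens x * f x).
Proof.
move=> d2 cf_ cf fK ff.
have ffE x : (gdens x * f_ m x)%:E @[m --> \oo] --> (gdens x * f x)%:E.
  by apply: cvg_EFin; [exact: nearW|apply: cvgM; [exact: cvg_cst|exact: ff]].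
have [|||||fi _ H] := @dominated_convergence _ _ R mu setT measurableT
  (fun m => EFin \o (fun x => gdens x * f_ m x)) (EFin \o (fun x => gdens x * f x))
  (EFin \o (fun x => gdens x * (K * expR (d * x ^+ 2)))).
- by move=> m; apply/measurable_EFinP; apply: gauss_measurable.
- by apply/measurable_EFinP; apply: gauss_measurable.
- by apply: aeW => x _; exact: ffE.
- exact: gmass_integrable.
- by apply: aeW => x m _; rewrite /= lee_fin; exact: gauss_le.
by apply: fine_cvg; rewrite fineK//; exact: integrable_fin_num fi.
Qed.

End GaussianLine.

(** * Dominated convergence for iterated Gaussian integrals *)

Section RealSequences.
Variable R : realType.
Implicit Types (u v : nat -> R) (a b : R).

Lemma cvg_seqD u v a b : u m @[m --> \oo] --> a -> v m @[m --> \oo] --> b ->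
  u m + v m @[m --> \oo] --> a + b.
Proof. exact: cvgD. Qed.

Lemma cvg_seqN u a : u m @[m --> \oo] --> a -> - u m @[m --> \oo] --> - a.
Proof. exact: cvgN. Qed.

Lemma cvg_seqM u v a b : u m @[m --> \oo] --> a -> v m @[m --> \oo] --> b ->
  u m * v m @[m --> \oo] --> a * b.
Proof. exact: cvgM. Qed.

Lemma cvg_seqX u a k : u m @[m --> \oo] --> a -> u m ^+ k @[m --> \oo] --> a ^+ k.
Proof.
move=> ua; elim: k => [|k IH]; first by rewrite expr0; exact: cvg_cst.
under eq_fun do rewrite exprS.
by rewrite exprS; exact: cvg_seqM.
Qed.

Lemma cvg_seq_expR u a : u m @[m --> \oo] --> a -> expR (u m) @[m --> \oo] --> expR a.
Proof. by move=> ua; apply: (cvg_comp _ expR ua); exact: continuous_expR. Qed.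

Lemma cvg_seq_sum n (u_ : 'I_n -> nat -> R) (a_ : 'I_n -> R) :
  (forall i, u_ i m @[m --> \oo] --> a_ i) ->
  \sum_(i < n) u_ i m @[m --> \oo] --> \sum_(i < n) a_ i.
Proof.
move=> ua; elim: (index_enum _) => [|i r IH].
  by under eq_fun do rewrite big_nil; rewrite big_nil; exact: cvg_cst.
under eq_fun do rewrite big_cons.
by rewrite big_cons; exact: cvg_seqD.
Qed.

Lemma cvg_seq_norm_le u a K : u m @[m --> \oo] --> a -> (forall m, `|u m| <= K) ->
  `|a| <= K.
Proof. by move=> /cvg_norm ua uK; apply: (cvgr_to_le ua); exact: nearW. Qed.

End RealSequences.

Section GaussianIntegral.
Variable R : realType.
Implicit Types (x y b d K : R) (n m k : nat) (f g : seq R -> R) (s : seq R).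
Local Notation mu := (@lebesgue_measure R).

Lemma sumsq_cons n x s : sumsq n.+1 (x :: s) = x ^+ 2 + sumsq n s.
Proof. by rewrite /sumsq big_ord_recl. Qed.

Lemma sumsq0 s : sumsq 0 s = 0.
Proof. by rewrite /sumsq big_ord0. Qed.

Lemma sumsq_ge0 n s : 0 <= sumsq n s.
Proof. by apply: sumr_ge0 => i _; exact: sqr_ge0. Qed.

Definition seqcvg n (s_ : nat -> seq R) s :=
  forall i, (i < n)%N -> zc (s_ m) i @[m --> \oo] --> zc s i.

(* Sequential continuity in the first n coordinates; in particular f depends on
   these coordinates only. *)
Definition seqcont n f := forall (s_ : nat -> seq R) s,
  seqcvg n s_ s -> f (s_ m) @[m --> \oo] --> f s.

(** [K] is kept apart from [d] because fixing the head coordinate [x] multiplies [K] by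
    [expR (d * x ^+ 2)] and leaves [d] unchanged, which is what an induction on [n] requires. *)
Definition gdom n d K f := forall s, `|f s| <= K * expR (d * sumsq n s).

Lemma gdom_ge0 n d K f : gdom n d K f -> 0 <= K.
Proof.
move=> /(_ [::]) H; rewrite -(pmulr_lge0 _ (expR_gt0 (d * sumsq n [::]))).
exact: le_trans (normr_ge0 _) H.
Qed.

Lemma gdom_le n d K K' f : gdom n d K f -> K <= K' -> gdom n d K' f.
Proof.
by move=> H KK s; apply: (le_trans (H s)); rewrite ler_wpM2r// expR_ge0.
Qed.

Lemma gdom_le_exp n d d' K f : gdom n d K f -> d <= d' -> gdom n d' K f.
Proof.
move=> H dd s; apply: (le_trans (H s)); rewrite ler_wpM2l ?(gdom_ge0 H)//.
by rewrite ler_expR ler_wpM2r// sumsq_ge0.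
Qed.

Lemma gdom_cons n d K f x : gdom n.+1 d K f ->
  gdom n d (K * expR (d * x ^+ 2)) (fun s => f (x :: s)).
Proof. by move=> H s; rewrite -mulrA -expRD -mulrDr -sumsq_cons. Qed.

Lemma seqcvg_cons n (u : nat -> R) x (s_ : nat -> seq R) s :
  u m @[m --> \oo] --> x -> seqcvg n s_ s ->
  seqcvg n.+1 (fun m => u m :: s_ m) (x :: s).
Proof. by move=> ux ss [|i] //= iN; exact: ss. Qed.

Lemma seqcvg_cst n s : seqcvg n (fun=> s) s.
Proof. by move=> i _; exact: cvg_cst. Qed.

Lemma seqcont_cons n f x : seqcont n.+1 f -> seqcont n (fun s => f (x :: s)).
Proof. by move=> H s_ s ss; apply: H; apply: seqcvg_cons => //; exact: cvg_cst. Qed.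

Lemma cvg_seq_normb (u : nat -> R) x : u m @[m --> \oo] --> x ->
  exists2 M, 0 < M & forall m, `|u m| <= M.
Proof.
move=> ux; have : cvgn u by apply/cvg_ex; exists x.
move=> /cvg_seq_bounded/pinfty_ex_gt0[M M0 H].
by exists M => // m; apply: H.
Qed.

Lemma seqcvg_sumsq n (s_ : nat -> seq R) s : seqcvg n s_ s ->
  sumsq n (s_ m) @[m --> \oo] --> sumsq n s.
Proof.
move=> ss; by apply: cvg_seq_sum => i; apply/cvg_seqX/ss.
Qed.

(** The bound and the convergence are proved together: in dimension [n.+1] the outer integrand must
    be continuous, hence measurable, which is the convergence statement in dimension [n], and
    dominated, which is the bound in dimension [n]. *)
Lemma gexp_bound_cvg d n : d < 1 / 2 ->
  (forall f K, seqcont n f -> gdom n d K f -> `|gexp n f| <= K * gmass d ^+ n) /\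
  (forall (f_ : nat -> seq R -> R) f K, (forall m, seqcont n (f_ m)) ->
    seqcont n f -> (forall m, gdom n d K (f_ m)) ->
    (forall s, f_ m s @[m --> \oo] --> f s) ->
    gexp n (f_ m) @[m --> \oo] --> gexp n f).
Proof.
move=> d2; have M0 := gmass_gt0 d2; elim: n => [|n [IHb IHc]].
  split=> [f K _ /(_ [::])|f_ f K _ _ _]; last exact.
  by rewrite sumsq0 mulr0 expR0 expr0.
have cG f K : seqcont n.+1 f -> gdom n.+1 d K f ->
    continuous (fun x => gexp n (fun s => f (x :: s))).
  move=> cf fK x; apply/(@cvg_nbhsP _ R^o) => u ux.
  (* The head coordinate moves along a convergent sequence; boundedness of this factor gives one
     dominating constant for all [m]. *)
  have : expR (d * u m ^+ 2) @[m --> \oo] --> expR (d * x ^+ 2).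
    by apply/cvg_seq_expR/cvg_seqM; [exact: cvg_cst|exact: cvg_seqX].
  move=> /cvg_seq_normb[M _ uM].
  apply: (IHc _ _ (K * M)) => [m|||s].
  - exact: seqcont_cons.
  - exact: seqcont_cons.
  - move=> m; apply: gdom_le (gdom_cons (u m) fK) _.
    rewrite ler_wpM2l ?(gdom_ge0 fK)//.
    by apply: le_trans (uM m); exact: ler_norm.
  - by apply: cf; apply: seqcvg_cons => //; exact: seqcvg_cst.
have bG f K : seqcont n.+1 f -> gdom n.+1 d K f -> forall x,
    `|gexp n (fun s => f (x :: s))| <= K * gmass d ^+ n * expR (d * x ^+ 2).
  move=> cf fK x; rewrite mulrAC; apply: IHb; first exact: seqcont_cons.
  exact: gdom_cons.
split=> [f K cf fK|f_ f K cf_ cf fK ff] /=.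
  rewrite exprSr mulrA; apply: gauss_bound => //; first exact: cG cf fK.
  exact: bG.
have fK' : gdom n.+1 d K f.
  by move=> s; apply: cvg_seq_norm_le (ff s) _ => m; exact: fK.
apply: (gauss_cvg (d := d) (K := K * gmass d ^+ n)) => //.
- by move=> m; exact: cG (cf_ m) (fK m).
- exact: cG cf fK'.
- by move=> m x; exact: bG.
- move=> x; apply: (IHc _ _ (K * expR (d * x ^+ 2))) => [m|||s].
  + exact: seqcont_cons.
  + exact: seqcont_cons.
  + by move=> m; exact: gdom_cons.
  + exact: ff.
Qed.
End GaussianIntegral.

(** * Linearity, monotonicity and explicit values of iterated Gaussian integrals *)

Section GaussianIntegralTheory.
Variable R : realType.
Implicit Types (x y b d K : R) (n m k : nat) (f g : seq R -> R) (s : seq R).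
Local Notation mu := (@lebesgue_measure R).

Lemma gexp_eq n f g : (forall s, size s = n -> f s = g s) -> gexp n f = gexp n g.
Proof.
elim: n f g => [|n IH] f g fg /=; first exact: fg.
by apply: eq_Rintegral => x _; congr (_ * _); apply: IH => s sn; apply: fg; rewrite /= sn.
Qed.

Lemma gexp_ge0 n f : (forall s, 0 <= f s) -> 0 <= gexp n f.
Proof.
elim: n f => [|n IH] f f0 //=; apply: Rintegral_ge0 => x _.
by rewrite mulr_ge0 ?gdens_ge0// IH.
Qed.

Lemma gexp_cat m n f :
  gexp (m + n) f = gexp m (fun s => gexp n (fun s' => f (s ++ s'))).
Proof.
elim: m f => [//|m IH] f; rewrite addSn /=.
by apply: eq_Rintegral => x _; rewrite IH.
Qed.

(** Plays the role of integrability for [gexp]. The exponent is fixed and the constant is free, so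
    that sums and multiples stay in the class. *)
Definition gadm n d f := seqcont n f /\ exists K, gdom n d K f.

Lemma gexp_bound n d K f : d < 1 / 2 -> seqcont n f -> gdom n d K f ->
  `|gexp n f| <= K * gmass d ^+ n.
Proof. by move=> d2; exact: (gexp_bound_cvg n d2).1. Qed.

Lemma gexp_cvg n d K (f_ : nat -> seq R -> R) f : d < 1 / 2 ->
  (forall m, seqcont n (f_ m)) -> seqcont n f -> (forall m, gdom n d K (f_ m)) ->
  (forall s, f_ m s @[m --> \oo] --> f s) ->
  gexp n (f_ m) @[m --> \oo] --> gexp n f.
Proof. by move=> d2; exact: (gexp_bound_cvg n d2).2. Qed.

Lemma gadm_cons n d f x : gadm n.+1 d f -> gadm n d (fun s => f (x :: s)).
Proof.
move=> [cf [K fK]]; split; first exact: seqcont_cons.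
by exists (K * expR (d * x ^+ 2)); exact: gdom_cons.
Qed.

Section LinearOps.
Variables (n : nat) (d : R).

Lemma seqcontD f g : seqcont n f -> seqcont n g -> seqcont n (fun s => f s + g s).
Proof. by move=> cf cg s_ s ss; apply: cvg_seqD; [exact: cf|exact: cg]. Qed.

Lemma seqcontM f g : seqcont n f -> seqcont n g -> seqcont n (fun s => f s * g s).
Proof. by move=> cf cg s_ s ss; apply: cvg_seqM; [exact: cf|exact: cg]. Qed.

Lemma seqcontN f : seqcont n f -> seqcont n (fun s => - f s).
Proof. by move=> cf s_ s ss; apply/cvg_seqN/cf. Qed.

Lemma seqcont_cst c : seqcont n (fun=> c : R).
Proof. by move=> s_ s ss; exact: cvg_cst. Qed.

Lemma seqcontX f k : seqcont n f -> seqcont n (fun s => f s ^+ k).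
Proof. by move=> cf s_ s ss; apply/cvg_seqX/cf. Qed.

Lemma seqcont_expR f : seqcont n f -> seqcont n (fun s => expR (f s)).
Proof. by move=> cf s_ s ss; apply: cvg_seq_expR; exact: cf. Qed.

Lemma seqcont_sum k (f_ : 'I_k -> seq R -> R) : (forall i, seqcont n (f_ i)) ->
  seqcont n (fun s => \sum_(i < k) f_ i s).
Proof. by move=> cf s_ s ss; apply: cvg_seq_sum => i; exact: cf. Qed.

Lemma seqcont_zc i : (i < n)%N -> seqcont n (fun s : seq R => zc s i).
Proof. by move=> iN s_ s; exact. Qed.

Lemma seqcont_sumsq : seqcont n (@sumsq R n).
Proof. by move=> s_ s; exact: seqcvg_sumsq. Qed.

Lemma gadmD f g : gadm n d f -> gadm n d g -> gadm n d (fun s => f s + g s).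
Proof.
move=> [cf [K fK]] [cg [L gL]]; split; first exact: seqcontD.
exists (K + L) => s; rewrite mulrDl (le_trans (ler_normD _ _))//.
by rewrite lerD ?fK ?gL.
Qed.

Lemma gadmZ c f : gadm n d f -> gadm n d (fun s => c * f s).
Proof.
move=> [cf [K fK]]; split; first by apply: seqcontM => //; exact: seqcont_cst.
by exists (`|c| * K) => s; rewrite normrM -mulrA ler_wpM2l.
Qed.

Lemma gadmN f : gadm n d f -> gadm n d (fun s => - f s).
Proof.
move=> [cf [K fK]]; split; first exact: seqcontN.
by exists K => s; rewrite normrN.
Qed.

Lemma gadmB f g : gadm n d f -> gadm n d g -> gadm n d (fun s => f s - g s).
Proof. by move=> cf cg; apply: gadmD => //; exact: gadmN. Qed.

Lemma gadm_cst c : 0 <= d -> gadm n d (fun=> c).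
Proof.
move=> d0; split; first exact: seqcont_cst.
exists `|c| => s; rewrite ler_peMr// -[leLHS]expR0 ler_expR.
by rewrite mulr_ge0// sumsq_ge0.
Qed.

Lemma gadm_sum k (f_ : 'I_k -> seq R -> R) : 0 <= d -> (forall i, gadm n d (f_ i)) ->
  gadm n d (fun s => \sum_(i < k) f_ i s).
Proof.
move=> d0 cf; elim: (index_enum _) => [|i r IH].
  by under eq_fun do rewrite big_nil; exact: gadm_cst.
by under eq_fun do rewrite big_cons; exact: gadmD.
Qed.

End LinearOps.

Section Linear.
Variable (d : R).
Hypothesis d2 : d < 1 / 2.

Lemma gexp_cons_continuous n K f : seqcont n.+1 f -> gdom n.+1 d K f ->
  continuous (fun x => gexp n (fun s => f (x :: s))).
Proof.
move=> cf fK x; apply/(@cvg_nbhsP _ R^o) => u ux.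
have : expR (d * u m ^+ 2) @[m --> \oo] --> expR (d * x ^+ 2).
  by apply/cvg_seq_expR/cvg_seqM; [exact: cvg_cst|exact: cvg_seqX].
move=> /cvg_seq_normb[M _ uM].
apply: (@gexp_cvg n d (K * M)) => // [m|||s].
- exact: seqcont_cons.
- exact: seqcont_cons.
- move=> m; apply: gdom_le (gdom_cons (u m) fK) _.
  rewrite ler_wpM2l ?(gdom_ge0 fK)//.
  by apply: le_trans (uM m); exact: ler_norm.
- by apply: cf; apply: seqcvg_cons => //; exact: seqcvg_cst.
Qed.

Lemma gexp_cons_integrable n f : gadm n.+1 d f ->
  mu.-integrable setT (EFin \o (fun x => gdens x * gexp n (fun s => f (x :: s)))).
Proof.
move=> [cf [K fK]]; apply: (gauss_integrable (d := d) (K := K * gmass d ^+ n)) => //.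
  exact: gexp_cons_continuous fK.
move=> x; rewrite mulrAC; apply: gexp_bound => //; first exact: seqcont_cons.
exact: gdom_cons.
Qed.

Lemma gexpD n f g : gadm n d f -> gadm n d g ->
  gexp n (fun s => f s + g s) = gexp n f + gexp n g.
Proof.
elim: n f g => [//|n IH] f g cf cg /=.
rewrite -RintegralD//; [|exact: gexp_cons_integrable..].
apply: eq_Rintegral => x _; rewrite -mulrDr; congr (_ * _).
by apply: IH; exact: gadm_cons.
Qed.

Lemma gexpZ n c f : gadm n d f -> gexp n (fun s => c * f s) = c * gexp n f.
Proof.
elim: n f => [//|n IH] f cf /=.
rewrite -RintegralZl//; last exact: gexp_cons_integrable.
apply: eq_Rintegral => x _; rewrite mulrCA; congr (_ * _).
by apply: IH; exact: gadm_cons.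
Qed.

Lemma gexpN n f : gadm n d f -> gexp n (fun s => - f s) = - gexp n f.
Proof.
move=> cf; rewrite -mulN1r -gexpZ//; congr gexp.
by apply/funext => s; rewrite mulN1r.
Qed.

Lemma gexpB n f g : gadm n d f -> gadm n d g ->
  gexp n (fun s => f s - g s) = gexp n f - gexp n g.
Proof. by move=> cf cg; rewrite gexpD ?gexpN//; exact: gadmN. Qed.

Lemma gexp_cst n c : gexp n (fun=> c : R) = c.
Proof.
elim: n c => [//|n IH] c /=; rewrite IH.
have := @gdens_exp_integral R 0 0; rewrite mulr0 subr0 sqrtr1 invr1 mul1r.
rewrite expr0n /= !mul0r expR0 mulr1 => H; rewrite -[RHS]mulr1 -H; last lra.
rewrite -RintegralZl//; last by apply: gdens_exp_integrable; lra.
by apply: eq_Rintegral => x _; rewrite !mul0r addr0 expR0 mulr1 mulrC.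
Qed.

Lemma gexp_sum n k (f_ : 'I_k -> seq R -> R) : 0 <= d -> (forall i, gadm n d (f_ i)) ->
  gexp n (fun s => \sum_(i < k) f_ i s) = \sum_(i < k) gexp n (f_ i).
Proof.
move=> d0 cf; elim: (index_enum _) => [|i r IH].
  by under eq_fun do rewrite big_nil; rewrite big_nil gexp_cst.
rewrite big_cons -IH -gexpD//.
  by congr gexp; apply/funext => s; rewrite big_cons.
elim: r {IH} => [|j r IH]; first by under eq_fun do rewrite big_nil; exact: gadm_cst.
by under eq_fun do rewrite big_cons; exact: gadmD.
Qed.

Lemma gexp_le n f g : gadm n d f -> gadm n d g -> (forall s, f s <= g s) ->
  gexp n f <= gexp n g.
Proof.
move=> cf cg fg; rewrite -subr_ge0 -gexpB//.
by apply: gexp_ge0 => s; rewrite subr_ge0.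
Qed.

Lemma gexp_norm_le n f g : gadm n d f -> gadm n d g -> (forall s, `|f s| <= g s) ->
  `|gexp n f| <= gexp n g.
Proof.
move=> cf cg fg; rewrite ler_norml -gexpN//; apply/andP; split; apply: gexp_le => //.
- exact: gadmN.
- by move=> s; have := fg s; rewrite ler_norml => /andP[].
- by move=> s; have := fg s; rewrite ler_norml => /andP[].
Qed.

End Linear.

(** The margin [d' - d] absorbs the linear term coordinate by coordinate, by completing the
    square. *)
Lemma gadm_expR n (b : nat -> R) d d' : d < d' ->
  gadm n d' (fun s => expR (\sum_(i < n) b i * zc s i + d * sumsq n s)).
Proof.
move=> dd; split.
  apply: seqcont_expR; apply: seqcontD.
    by apply: seqcont_sum => i; apply: seqcontM; [exact: seqcont_cst|exact: seqcont_zc].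
  by apply: seqcontM; [exact: seqcont_cst|exact: seqcont_sumsq].
exists (expR (\sum_(i < n) b i ^+ 2 / (4 * (d' - d)))) => s.
rewrite ger0_norm ?expR_ge0// -expRD ler_expR -lerBrDr -addrA -mulrBl mulr_sumr.
rewrite -big_split; apply: ler_sum => i _ /=.
have e0 : 0 < d' - d by rewrite subr_gt0.
rewrite -subr_ge0 (_ : _ - _ = (d' - d) * (zc s i - b i / (2 * (d' - d))) ^+ 2).
  by rewrite mulr_ge0 ?sqr_ge0// ltW.
by field; rewrite gt_eqF.
Qed.

Lemma gexp_expR n (b : nat -> R) d : d < 1 / 2 ->
  let v := (Num.sqrt (1 - 2 * d))^-1 in
  gexp n (fun s => expR (\sum_(i < n) b i * zc s i + d * sumsq n s)) =
  v ^+ n * expR (v ^+ 2 / 2 * \sum_(i < n) b i ^+ 2).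
Proof.
move=> d2 v; elim: n b => [|n IH] b /=.
  by rewrite !big_ord0 sumsq0 !mulr0 addr0 expR0 mulr1.
transitivity (\int[mu]_x ((v ^+ n * expR (v ^+ 2 / 2 * \sum_(i < n) b i.+1 ^+ 2)) *
   (gdens x * expR (b 0 * x + d * x ^+ 2)))).
  apply: eq_Rintegral => x _; rewrite mulrCA; congr (_ * _).
  rewrite -(IH (fun i => b i.+1)) [RHS]mulrC.
  (* The midpoint of [d] and 1/2 leaves room for the linear term and stays integrable. *)
  have gE : gadm n ((d + 1 / 2) / 2)
      (fun s => expR (\sum_(i < n) b i.+1 * zc s i + d * sumsq n s)).
    by apply: (@gadm_expR n (fun i => b i.+1)); lra.
  rewrite -(gexpZ _ _ gE); last lra.
  congr gexp; apply/funext => s.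
  have -> : \sum_(i < n.+1) b i * zc (x :: s) i =
    b 0%N * x + \sum_(i < n) b i.+1 * zc s i by rewrite big_ord_recl.
  by rewrite -expRD sumsq_cons; congr expR; ring.
rewrite RintegralZl//; last exact: gdens_exp_integrable.
have -> : \sum_(i < n.+1) b i ^+ 2 = b 0%N ^+ 2 + \sum_(i < n) b i.+1 ^+ 2.
  by rewrite big_ord_recl.
rewrite gdens_exp_integral// -/v [v ^+ n.+1]exprS mulrDr expRD.
rewrite (_ : b 0%N ^+ 2 * _ / 2 = v ^+ 2 / 2 * b 0%N ^+ 2); last by ring.
by ring.
Qed.

End GaussianIntegralTheory.

(** * Differentiation under the integral and integration by parts *)

Section Derivatives.
Variable R : realType.
Implicit Types (x y b d K r : R) (n m k : nat) (f g : seq R -> R) (s : seq R).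
Local Notation mu := (@lebesgue_measure R).

(** The inequality [1 + x <= expR x] at [x = e y / k], raised to the power [k]. *)
Lemma poly_le_expR k (e : R) : 0 < e ->
  exists2 C, 0 < C & forall y, 0 <= y -> (1 + y) ^+ k <= C * expR (e * y).
Proof.
move=> e0; case: k => [|k].
  exists 1 => // y y0; rewrite expr0 mul1r -[leLHS]expR0 ler_expR.
  by rewrite mulr_ge0// ltW.
have [c [c0 cE]] : exists c : R, 0 < c /\ c = k.+1%:R by exists k.+1%:R.
have c1 : 0 < 1 + c / e by rewrite addr_gt0// divr_gt0.
exists ((1 + c / e) ^+ k.+1) => [|y y0]; first exact: exprn_gt0.
have -> : e * y = (e / c * y) * k.+1%:R by rewrite -cE; field; rewrite gt_eqF.
rewrite expRM_natr -exprMn; apply: lerXn2r; rewrite ?nnegrE.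
- by rewrite addr_ge0.
- by rewrite mulr_ge0 ?expR_ge0// ltW.
apply: (@le_trans _ _ ((1 + c / e) * (1 + e / c * y))); last first.
  by rewrite ler_pM2l// expR_ge1Dx.
have -> : (1 + c / e) * (1 + e / c * y) = 1 + y + (c / e + e / c * y).
  by field; rewrite !gt_eqF.
by rewrite lerDl addr_ge0 ?mulr_ge0 ?invr_ge0 ?(ltW e0) ?(ltW c0).
Qed.

(** Dominated convergence speaks of sequences, and domination holds only near [x]; so
    differentiability is tested on sequences of nonzero increments that stay below a fixed radius
    [r]. *)
Lemma is_derive_seq (F : R -> R) x l r : 0 < r ->
  (forall h : nat -> R, (forall m, h m != 0) -> (forall m, `|h m| < r) ->
     h m @[m --> \oo] --> 0 -> (h m)^-1 * (F (h m + x) - F x) @[m --> \oo] --> l) ->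
  is_derive x 1 F l.
Proof.
move=> r0 H.
have D : h^-1 *: (F (h + x) - F x) @[h --> 0^'] --> l.
  apply/cvgr_dnbhsP => h [h0 hc].
  (* Only finitely many terms change; [r / 2] is any nonzero increment inside the window. *)
  pose h' m := if `|h m| < r then h m else r / 2.
  have near_h : \forall m \near \oo, h m = h' m.
    move/cvgr0_norm_lt : (hc) => /(_ _ r0); apply: filterS => m hm.
    by rewrite /h' hm.
  have h'0 m : h' m != 0.
    by rewrite /h'; case: ifP => // _; rewrite gt_eqF// divr_gt0.
  have h'r m : `|h' m| < r.
    by rewrite /h'; case: ifPn => // _; rewrite gtr0_norm ?divr_gt0//; lra.
  have h'c : h' m @[m --> \oo] --> 0.
    by apply: cvg_trans hc; apply: near_eq_cvg; exact: filterS near_h.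
  apply: cvg_trans (H _ h'0 h'r h'c); apply: near_eq_cvg.
  by apply: filterS near_h => m hm; rewrite -hm.
have D' : h^-1 *: (F (h *: (1 : R) + x) - F x) @[h --> 0^'] --> l.
  by under eq_fun do rewrite [_ *: 1]mulr1.
split; first by apply/cvg_ex; exists l.
exact: cvg_lim D'.
Qed.

Lemma is_derive_lipschitz (F F' : R -> R) x r K :
  (forall y, `|y - x| < r -> is_derive y 1 F (F' y)) ->
  (forall y, `|y - x| < r -> `|F' y| <= K) ->
  forall h, `|h| < r -> `|F (h + x) - F x| <= K * `|h|.
Proof.
move=> dF F'K h hr.
have K0 : 0 <= K.
  apply: le_trans (F'K x _) => //; rewrite subrr normr0.
  exact: le_lt_trans hr.
have cF y : `|y - x| < r -> {for y, continuous F}.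
  by move=> /dF dFy; apply/differentiable_continuous/derivable1_diffP; case: dFy.
have gen a b : a < b -> (forall y, y \in `[a, b] -> `|y - x| < r) ->
    `|F b - F a| <= K * (b - a).
  move=> ab sub.
  have [||c cab ->] := @MVT _ F F' a b ab.
  - by move=> y yab; apply/dF/sub; exact: subset_itv_oo_cc yab.
  - apply: continuous_in_subspaceT => y; rewrite inE => yab.
    exact/cF/sub.
  - rewrite normrM [`|b - a|]gtr0_norm ?subr_gt0// ler_wpM2r ?subr_ge0 ?(ltW ab)//.
    by apply/F'K/sub; exact: subset_itv_oo_cc cab.
have [h0|h0|h0] := ltgtP h 0.
- rewrite distrC [`|h|]ltr0_norm// -[- h](_ : x - (h + x) = _); last by ring.
  apply: gen; first lra.
  move=> y; rewrite in_itv /= => /andP[y1 y2].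
  by move: hr; rewrite !ltr_norml => /andP[? ?]; apply/andP; split; lra.
- rewrite [`|h|]gtr0_norm// -[X in K * X](_ : (h + x) - x = _); last by ring.
  apply: gen; first lra.
  move=> y; rewrite in_itv /= => /andP[y1 y2].
  by move: hr; rewrite !ltr_norml => /andP[? ?]; apply/andP; split; lra.
- by rewrite h0 add0r subrr normr0 mulr0.
Qed.

(** By the mean value theorem a local bound on the derivative dominates the difference quotients,
    and dominated convergence applies to them. *)
Lemma gexp_derive n d K (f f' : R -> seq R -> R) x r : d < 1 / 2 -> 0 < r ->
  (forall y, `|y - x| < r -> gadm n d (f y)) -> seqcont n (f' x) ->
  (forall y s, `|y - x| < r -> is_derive y 1 (f ^~ s) (f' y s)) ->
  (forall y, `|y - x| < r -> gdom n d K (f' y)) ->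
  is_derive x 1 (fun y => gexp n (f y)) (gexp n (f' x)).
Proof.
move=> d2 r0 fa cf' df f'K; apply: (is_derive_seq r0) => h h0 hr hc.
have hx m : `|h m + x - x| < r by rewrite addrK.
have xx : `|x - x| < r by rewrite subrr normr0.
have fax := fa _ xx.
have E m : (h m)^-1 * (gexp n (f (h m + x)) - gexp n (f x)) =
    gexp n (fun s => (h m)^-1 * (f (h m + x) s - f x s)).
  rewrite (@gexpZ _ d)//; last by apply: gadmB => //; exact: fa.
  by rewrite (@gexpB _ d)//; exact: fa.
under eq_fun do rewrite E.
apply: (@gexp_cvg _ n d K) => // [m|m s|s].
- apply: seqcontM; first exact: seqcont_cst.
  by apply: seqcontD; [exact: (fa _ (hx m)).1|apply: seqcontN; exact: fax.1].
- rewrite normrM normfV ler_pdivrMl ?normr_gt0// mulrC.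
  by apply: (is_derive_lipschitz (fun y => @df y s)) => // y yr; exact: f'K.
- have [dr /=] := df x s xx.
  move=> dE; have := dr; rewrite /derivable => /cvg_ex[l lE].
  have ll : l = f' x s by rewrite -dE; apply/esym/cvg_lim.
  move: lE; rewrite ll => /cvgr_dnbhsP/(_ h (conj h0 hc)).
  by under eq_fun do rewrite [_ *: 1]mulr1.
Qed.

End Derivatives.

(** * Gaussian integration by parts *)

Section IntegrationByParts.
Variable R : realType.
Implicit Types (x y b d K r : R) (n m k : nat) (f g : seq R -> R) (s : seq R).
Local Notation mu := (@lebesgue_measure R).

Lemma is_derive_gdens x : is_derive x 1 (@gdens R) (- (x * gdens x)).
Proof.
pose h := fun y : R => - y ^+ 2 / 2.
have H : is_derive x 1 h (- x).
  have -> : h = (- 2^-1) \*: (id ^+ 2 : R -> R).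
    by apply/funext => y; rewrite /h /= /GRing.scale /= fctE; ring.
  by apply: is_derive_eq; rewrite /GRing.scale /= expr1; field.
have H2 := @is_derive1_comp _ expR h x _ _ (is_derive_expR _) H.
have -> : @gdens R = (Num.sqrt (2 * pi))^-1 \*: (expR \o h) by [].
by apply: is_derive_eq; rewrite /= /GRing.scale /=; ring.
Qed.

Lemma norm_le_expR (e : R) : 0 < e ->
  exists2 C, 0 < C & forall x, `|x| <= C * expR (e * x ^+ 2).
Proof.
move=> e0; have [C C0 HC] := poly_le_expR 1 e0; exists C => // x.
apply: le_trans (HC (x ^+ 2) (sqr_ge0 _)); rewrite expr1 -real_normK ?num_real//.
have := sqr_ge0 (`|x| - 1); have := sqr_ge0 `|x|; lra.
Qed.

Lemma cvg_expR_sqr (c : R) : 0 < c -> expR (- (c * m%:R ^+ 2)) @[m --> \oo] --> (0 : R).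
Proof.
move=> c0; apply/cvgrPdist_le => e e0; near=> m.
rewrite sub0r normrN ger0_norm ?expR_ge0// expRN.
rewrite invf_ple ?posrE ?expR_gt0//.
have m0 : 0 <= c * m%:R ^+ 2 by rewrite mulr_ge0 ?sqr_ge0// ltW.
apply: le_trans (expR_ge1Dx _).
have : e^-1 / c <= m%:R by near: m; exact: nbhs_infty_ger.
rewrite ler_pdivrMr// => H.
have m1 : 1 <= m%:R :> R by rewrite ler1n; near: m; exact: nbhs_infty_gt.
apply: (le_trans H); rewrite mulrC.
have : c * m%:R <= c * m%:R ^+ 2 by rewrite ler_pM2l// expr2 ler_peMr.
by lra.
Unshelve. all: by end_near. Qed.

(** [gdens * (G' - x G)] is the derivative of [gdens * G]. Its integral over a growing symmetric
    interval equals boundary terms, which vanish since [d < 1 / 2]. *)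
Lemma gauss_ibp d K (G G' : R -> R) : d < 1 / 2 ->
  (forall x, is_derive x 1 G (G' x)) -> continuous G' ->
  (forall x, `|G x| <= K * expR (d * x ^+ 2)) ->
  (forall x, `|G' x| <= K * expR (d * x ^+ 2)) ->
  \int[mu]_x (gdens x * (x * G x)) = \int[mu]_x (gdens x * G' x).
Proof.
move=> d2 dG cG' GK G'K.
have cG : continuous G.
  by move=> x; apply/differentiable_continuous/derivable1_diffP; case: (dG x).
(* The factor [x] costs a little of the exponent, hence a [d'] strictly between [d] and 1/2. *)
have [d' [dd' d'2]] : exists d', d < d' /\ d' < 1 / 2.
  by exists ((d + 1 / 2) / 2); split; lra.
have [C C0 HC] := @norm_le_expR (d' - d) ltac:(lra).
have K0 : 0 <= K.
  have := GK 0; rewrite expr0n mulr0 expR0 mulr1; exact: le_trans.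
have xGK x : `|x * G x| <= C * K * expR (d' * x ^+ 2).
  rewrite normrM; apply: (@le_trans _ _ ((C * expR ((d' - d) * x ^+ 2)) * (K * expR (d * x ^+ 2)))).
    by rewrite ler_pM.
  by rewrite mulrACA -expRD -mulrDl subrK.
pose H x := G' x - x * G x.
have cH : continuous H.
  by move=> x; apply: cvgB; [exact: cG'|apply: cvgM; [exact: cvg_id|exact: cG]].
have HK x : `|H x| <= (K + C * K) * expR (d' * x ^+ 2).
  rewrite mulrDl; apply: (le_trans (ler_normB _ _)); apply: lerD; last exact: xGK.
  apply: le_trans (G'K x) _; rewrite ler_wpM2l// ler_expR ler_wpM2r ?sqr_ge0//.
  exact: ltW.
have iH := gauss_integrable d'2 cH HK.
have dH x : is_derive x 1 (fun y => gdens y * G y) (gdens x * H x).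
  have dg := is_derive_gdens x; have dGx := dG x.
  have -> : (fun y => gdens y * G y) = (@gdens R : R -> R) * G by [].
  by apply: is_derive_eq; rewrite /GRing.scale /= /H; ring.
have FTC m : \int[mu]_(x in `[- m.+1%:R, m.+1%:R]) (gdens x * H x) =
    gdens m.+1%:R * G m.+1%:R - gdens (- m.+1%:R) * G (- m.+1%:R).
  have m0 : (0 : R) < m.+1%:R by [].
  have cgG x : {for x, continuous (fun y => gdens y * G y)}.
    by apply: cvgM; [exact: continuous_gdens|exact: cG].
  rewrite /Rintegral (@continuous_FTC2 _ _ (fun y => gdens y * G y)) //.
  - lra.
  - apply: continuous_subspaceT => x.
    by apply: cvgM; [exact: continuous_gdens|exact: cH].
  - split; first by move=> x _; case: (dH x).
    + exact/cvg_at_right_filter/cgG.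
    + exact/cvg_at_left_filter/cgG.
  - by move=> x _; rewrite derive1E; have [_] := dH x.
have lim1 : \int[mu]_(x in `[- m.+1%:R, m.+1%:R]) (gdens x * H x) @[m --> \oo] -->
    \int[mu]_x (gdens x * H x).
  under eq_fun do rewrite /Rintegral integral_mkcond.
  have [|||||fi _ L] := @dominated_convergence _ _ R mu setT measurableT
    (fun m => ((EFin \o (fun x => gdens x * H x)) \_ `[- m.+1%:R, m.+1%:R]))
    (EFin \o (fun x => gdens x * H x))
    (EFin \o (fun x => `|gdens x * H x|)).
  - move=> m; apply/(measurable_restrictT _ _).1 => //.
    by apply/measurable_EFinP; apply: measurable_funTS; apply: gauss_measurable.
  - by apply/measurable_EFinP; apply: gauss_measurable.
  - apply: aeW => x _; apply: cvg_near_cst.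
    near=> m; rewrite patchE mem_set//= in_itv /= -ler_norml.
    have : `|x| <= m%:R by near: m; exact: nbhs_infty_ger.
    by move=> /le_trans; apply; rewrite ler_nat.
  - exact: integrable_norm iH.
  - apply: aeW => x m _; rewrite patchE; case: ifP => _; rewrite /= lee_fin//.
    by rewrite normr0.
  by apply: fine_cvg; rewrite fineK//; exact: integrable_fin_num fi.
have lim2 : \int[mu]_(x in `[- m.+1%:R, m.+1%:R]) (gdens x * H x) @[m --> \oo] --> 0.
  under eq_fun do rewrite FTC.
  pose c := (Num.sqrt (2 * pi))^-1 : R.
  have gG x : `|gdens x * G x| <= c * K * expR (- ((1 / 2 - d) * x ^+ 2)).
    apply: (le_trans (gauss_le GK x)); rewrite /gdens -/c mulrACA -expRD.
    by rewrite (_ : - x ^+ 2 / 2 + d * x ^+ 2 = - ((1 / 2 - d) * x ^+ 2)); last lra.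
  have e0 : expR (- ((1 / 2 - d) * m.+1%:R ^+ 2)) @[m --> \oo] --> (0 : R).
    have /cvg_expR_sqr : 0 < 1 / 2 - d by rewrite subr_gt0.
    by rewrite -(cvg_shiftS (fun m => expR (- ((1 / 2 - d) * m%:R ^+ 2)))).
  have ce0 : c * K * expR (- ((1 / 2 - d) * m.+1%:R ^+ 2)) @[m --> \oo] --> (0 : R).
    by rewrite -[X in _ --> X](mulr0 (c * K)); apply: cvg_seqM => //; exact: cvg_cst.
  have b1 : gdens m.+1%:R * G m.+1%:R @[m --> \oo] --> (0 : R).
    apply/norm_cvg0P; apply: (squeeze_cvgr _ (cvg_cst 0) ce0).
    by apply: nearW => m; rewrite normr_ge0 gG.
  have b2 : gdens (- m.+1%:R) * G (- m.+1%:R) @[m --> \oo] --> (0 : R).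
    apply/norm_cvg0P; apply: (squeeze_cvgr _ (cvg_cst 0) ce0).
    by apply: nearW => m; rewrite normr_ge0 /= (le_trans (gG _))// sqrrN.
  by have := cvg_seqD b1 (cvg_seqN b2); rewrite subr0.
have : \int[mu]_x (gdens x * H x) = 0.
  by apply: (cvg_unique _ lim1 lim2); exact: Rhausdorff.
rewrite (_ : (fun x => gdens x * H x) = (fun x => gdens x * G' x - gdens x * (x * G x))).
  rewrite RintegralB//.
  - by move=> /eqP; rewrite subr_eq0 => /eqP ->.
  - exact: gauss_integrable d2 cG' G'K.
  - apply: (gauss_integrable d'2 _ xGK) => x.
    by apply: cvgM; [exact: cvg_id|exact: cG].
by apply/funext => x; rewrite /H mulrBr.
Unshelve. all: by end_near. Qed.

(** For the head coordinate this is the one-dimensional formula applied to the inner integral,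
    differentiated under the integral sign; for a later one the outer integral is left alone and the
    induction hypothesis applies inside. *)
Lemma gexp_ibp n k d f f' : d < 1 / 2 -> (k < n)%N -> gadm n d f -> gadm n d f' ->
  (forall s y, is_derive y 1 (fun y => f (set_nth 0 s k y)) (f' (set_nth 0 s k y))) ->
  gexp n (fun s => zc s k * f s) = gexp n f'.
Proof.
move=> d2; elim: n k f f' => [//|n IH] [|k] f f' kn fa fa' df /=; last first.
  apply: eq_Rintegral => x _; congr (_ * _).
  apply: IH => //; [exact: gadm_cons..|].
  by move=> s y; exact: (df (x :: s) y).
have sG x : gexp n (fun s => zc (x :: s) 0 * f (x :: s)) = x * gexp n (fun s => f (x :: s)).
  by rewrite -(gexpZ d2)//; exact: gadm_cons.
under eq_Rintegral do rewrite sG.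
have [cf [K fK]] := fa; have [cf' [K' fK']] := fa'.
have cG' : continuous (fun x => gexp n (fun s => f' (x :: s))).
  exact: gexp_cons_continuous fK'.
apply: (@gauss_ibp d (Num.max K K' * gmass d ^+ n)) => //.
(* On the window [|y - x| < 1] one has [y^2 <= (|x| + 1)^2]; the absolute value of [d] covers a
   negative exponent. *)
- move=> x; apply: (@gexp_derive _ _ d (K' * expR (`|d| * (`|x| + 1) ^+ 2)) _ (fun x s => f' (x :: s)) x 1) => //.
  + by move=> y _; exact: gadm_cons.
  + exact: seqcont_cons.
  + by move=> y s _; exact: (df (0 :: s) y).
  + move=> y yx; apply: gdom_le (gdom_cons y fK') _.
    rewrite ler_wpM2l ?(gdom_ge0 fK')// ler_expR.
    apply: (@le_trans _ _ (`|d| * y ^+ 2)); first by rewrite ler_wpM2r ?sqr_ge0// ler_norm.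
    rewrite ler_wpM2l// -[y ^+ 2]real_normK ?num_real// lerXn2r ?nnegrE ?addr_ge0//.
    have := ler_normD (y - x) x; rewrite subrK; lra.
- move=> x; rewrite mulrAC; apply: gexp_bound => //; first exact: seqcont_cons.
  by apply: gdom_le (gdom_cons x fK) _; rewrite ler_wpM2r ?expR_ge0// le_max lexx.
- move=> x; rewrite mulrAC; apply: gexp_bound => //; first exact: seqcont_cons.
  by apply: gdom_le (gdom_cons x fK') _; rewrite ler_wpM2r ?expR_ge0// le_max lexx orbT.
Qed.

End IntegrationByParts.

(** * Gibbs measures with Gaussian disorder *)

Section Gibbs.
Variables (R : realType) (M N : nat) (phi : nat -> seq R -> R) (C e : R).
Implicit Types (c : nat -> R) (Psi f : seq R -> R) (g z : seq R) (K y t : R).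

Definition ham c Psi g z := \sum_(k < M) c k * zc g k * phi k z + Psi z.

(** [C] and [e] are shared by all Hamiltonians of the path, which makes every later estimate
    uniform. [adm_psi] serves the lower bound on the partition function, [adm_ub] the upper one. Of
    the margin [2 * e], one [e] pays for a polynomial factor or for [expR (e * sumsq N z)], and the
    other keeps [d = 1 / 2 - e] integrable. *)
Record admissible c Psi : Prop := Admissible {
  adm_cont : seqcont N Psi;
  adm_coef : forall k, (k < M)%N -> `|c k| <= C;
  adm_psi : forall z, `|Psi z| <= C * (1 + sumsq N z) ^+ 2;
  adm_ub : forall g z,
    ham c Psi g z <= C * (1 + sumsq M g) + (1 / 2 - 2 * e) * sumsq N z }.

Definition gint c Psi f g := gexp N (fun z => f z * expR (ham c Psi g z)).
Definition gpart c Psi g := gint c Psi (fun=> 1) g.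
Definition gavg c Psi f g := gint c Psi f g / gpart c Psi g.

Hypothesis e0 : 0 < e.
Hypothesis e8 : e <= 1 / 8.
Hypothesis C0 : 0 <= C.
Hypothesis phi_cont : forall k, (k < M)%N -> seqcont N (phi k).
Hypothesis phi_bound : forall k, (k < M)%N -> forall z, `|phi k z| <= 1 + sumsq N z.

Let d := 1 / 2 - e.
Let d2 : d < 1 / 2. Proof. by rewrite ltrBlDr ltrDl. Qed.
Let d0 : 0 <= d. Proof. by move: e8; rewrite /d; lra. Qed.

Definition quadratic K f := seqcont N f /\ forall z, `|f z| <= K * (1 + sumsq N z) ^+ 2.

Lemma sqr_ge1 (y : R) : 0 <= y -> 1 <= (1 + y) ^+ 2.
Proof. by move=> y0; rewrite expr_ge1 ?lerDl ?addr_ge0. Qed.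

Lemma quadratic_ge0 K f : quadratic K f -> 0 <= K.
Proof.
move=> [_ /(_ [::])]; move/(le_trans (normr_ge0 _)).
by rewrite pmulr_lge0// (lt_le_trans ltr01)// sqr_ge1// sumsq_ge0.
Qed.

Lemma quadratic_cst (a : R) : quadratic `|a| (fun=> a).
Proof.
by split=> [|z]; [exact: seqcont_cst|rewrite ler_peMr// sqr_ge1// sumsq_ge0].
Qed.

Lemma seqcont_ham c Psi g : seqcont N Psi -> seqcont N (ham c Psi g).
Proof.
move=> cP; apply: seqcontD => //; apply: seqcont_sum => k.
by apply: seqcontM; [exact: seqcont_cst|exact: phi_cont].
Qed.

(** [L] is chosen before the Hamiltonian, the observable and the disorder, so that the same
    domination serves along sequences of any of these data. *)
Lemma gibbs_dom : exists2 L, 0 < L & forall c Psi f K g, admissible c Psi ->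
  quadratic K f ->
  gdom N d (K * L * expR (C * (1 + sumsq M g))) (fun z => f z * expR (ham c Psi g z)).
Proof.
have [L L0 HL] := poly_le_expR 2 e0; exists L => // c Psi f K g [_ _ _ ub] qf z.
have K0 := quadratic_ge0 qf.
rewrite normrM (ger0_norm (expR_ge0 _)).
apply: (@le_trans _ _ (K * (L * expR (e * sumsq N z)) *
   expR (C * (1 + sumsq M g) + (1 / 2 - 2 * e) * sumsq N z))).
  rewrite ler_pM ?expR_ge0 ?ler_expR ?ub//.
  by rewrite (le_trans (qf.2 z))// ler_wpM2l// HL// sumsq_ge0.
rewrite expRD.
have -> : d * sumsq N z = e * sumsq N z + (1 / 2 - 2 * e) * sumsq N z by rewrite /d; ring.
by rewrite expRD le_eqVlt; apply/orP; left; apply/eqP; ring.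
Qed.

Lemma gibbs_gadm c Psi f K g : admissible c Psi -> quadratic K f ->
  gadm N d (fun z => f z * expR (ham c Psi g z)).
Proof.
move=> ad qf; have [L _ HL] := gibbs_dom; split; last first.
  by exists (K * L * expR (C * (1 + sumsq M g))); exact: HL.
apply: seqcontM; first exact: qf.1.
exact/seqcont_expR/seqcont_ham/(adm_cont ad).
Qed.

Lemma cvg_ham (c_ : nat -> nat -> R) c (Psi_ : nat -> seq R -> R) Psi (g_ : nat -> seq R) g z :
  (forall k, (k < M)%N -> c_ m k @[m --> \oo] --> c k) ->
  (forall z, Psi_ m z @[m --> \oo] --> Psi z) -> seqcvg M g_ g ->
  ham (c_ m) (Psi_ m) (g_ m) z @[m --> \oo] --> ham c Psi g z.
Proof.
move=> cc PP gg; apply: cvg_seqD; last exact: PP.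
apply: cvg_seq_sum => k; apply: cvg_seqM; last exact: cvg_cst.
by apply: cvg_seqM; [exact: cc|exact: gg].
Qed.

(** Coefficients, potential and disorder vary simultaneously: with the first two constant this is
    continuity in the disorder, with the last constant it is continuity along the path. *)
Lemma cvg_gint (c_ : nat -> nat -> R) c (Psi_ : nat -> seq R -> R) Psi (g_ : nat -> seq R) g f K :
  (forall m, admissible (c_ m) (Psi_ m)) -> admissible c Psi -> quadratic K f ->
  (forall k, (k < M)%N -> c_ m k @[m --> \oo] --> c k) ->
  (forall z, Psi_ m z @[m --> \oo] --> Psi z) -> seqcvg M g_ g ->
  gint (c_ m) (Psi_ m) f (g_ m) @[m --> \oo] --> gint c Psi f g.
Proof.
move=> ad_ ad qf cc PP gg; have [L L0 HL] := gibbs_dom.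
have [B B0 HB] := cvg_seq_normb (seqcvg_sumsq gg).
have K0 := quadratic_ge0 qf.
apply: (@gexp_cvg _ N d (K * L * expR (C * (1 + B)))) => // [m|||z].
- exact: (gibbs_gadm (g_ m) (ad_ m) qf).1.
- exact: (gibbs_gadm g ad qf).1.
- move=> m; apply: gdom_le (HL _ _ _ _ (g_ m) (ad_ m) qf) _.
  rewrite ler_wpM2l ?mulr_ge0 ?(ltW L0)// ler_expR ler_wpM2l// lerD2l.
  by apply: le_trans (HB m); exact: ler_norm.
- by apply: cvg_seqM; [exact: cvg_cst|exact/cvg_seq_expR/cvg_ham].
Qed.

Lemma norm_zc_le g k : (k < M)%N -> `|zc g k| <= 1 + sumsq M g.
Proof.
move=> kM; apply: (@le_trans _ _ (1 + zc g k ^+ 2)).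
  rewrite -[_ ^+ 2]real_normK ?num_real//.
  have := sqr_ge0 (`|zc g k| - 1); have := sqr_ge0 `|zc g k|; lra.
rewrite lerD2l /sumsq (bigD1 (Ordinal kM))//= lerDl.
by apply: sumr_ge0 => i _; exact: sqr_ge0.
Qed.

Lemma ham_bound c Psi g z : (forall k, (k < M)%N -> `|c k| <= C) ->
  (forall z, `|Psi z| <= C * (1 + sumsq N z) ^+ 2) ->
  `|ham c Psi g z| <= C * (M.+1)%:R * (1 + sumsq M g) * (1 + sumsq N z) ^+ 2.
Proof.
move=> cC PC; apply: (le_trans (ler_normD _ _)).
have r0 := sumsq_ge0 N z; have G0 := sumsq_ge0 M g.
set G := 1 + sumsq M g; set r := (1 + sumsq N z) ^+ 2.
have r1 : 0 <= r by exact: sqr_ge0.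
have G1 : 1 <= G by rewrite /G lerDl.
rewrite (_ : C * M.+1%:R * G * r = M%:R * (C * G * r) + G * (C * r)); last first.
  by rewrite -natr1; ring.
apply: lerD; last first.
  by apply: (le_trans (PC z)); rewrite -/r; apply: ler_peMl => //; apply: mulr_ge0.
apply: (le_trans (ler_norm_sum _ _ _)).
apply: (@le_trans _ _ (\sum_(k < M) C * G * r)).
  apply: ler_sum => k _; rewrite !normrM.
  rewrite ler_pM ?mulr_ge0//.
    by rewrite ler_pM// ?cC// norm_zc_le.
  apply: (le_trans (phi_bound (ltn_ord k) z)).
  by rewrite /r expr2 ler_peMr ?lerDl ?addr_ge0.
by rewrite sumr_const card_ord mulr_natl.
Qed.

(** Controls the denominator of Gibbs averages and the logarithm from below. The exponent comes from
    the Gaussian mean of [ham], hence is at most linear in [1 + sumsq M g]. *)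
Lemma gpart_lb : exists2 L, 0 <= L & forall c Psi g, admissible c Psi ->
  expR (- (L * (1 + sumsq M g))) <= gpart c Psi g.
Proof.
have [L L0 HL] := poly_le_expR 2 e0.
have e2 : e < 1 / 2 by move: e8; lra.
exists (C * M.+1%:R * L * gmass e ^+ N) => [|c Psi g ad].
  by rewrite !mulr_ge0 ?exprn_ge0// ?ltW// gmass_gt0.
have hd : gdom N e (C * M.+1%:R * (1 + sumsq M g) * L) (ham c Psi g).
  move=> z; apply: (le_trans (ham_bound g z (adm_coef ad) (adm_psi ad))); rewrite -[leRHS]mulrA.
  rewrite ler_wpM2l ?HL ?sumsq_ge0//.
  by rewrite !mulr_ge0// addr_ge0// sumsq_ge0.
have ch : seqcont N (ham c Psi g) by exact: seqcont_ham (adm_cont ad).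
have hle : gadm N d (ham c Psi g).
  split=> //; exists (C * M.+1%:R * (1 + sumsq M g) * L).
  by apply: gdom_le_exp hd _; move: e8; rewrite /d; lra.
(* Jensen's inequality, from the tangent line of expR at the mean of ham. *)
set m := gexp N (ham c Psi g).
apply: (@le_trans _ _ (expR m)).
  rewrite ler_expR lerNl; apply: (@le_trans _ _ `|m|).
    by rewrite -normrN ler_norm.
  apply: (le_trans (gexp_bound e2 ch hd)).
  by rewrite le_eqVlt; apply/orP; left; apply/eqP; ring.
have -> : expR m = gexp N (fun z => expR m * (1 - m + ham c Psi g z)).
  rewrite (gexpZ d2); last by apply: gadmD => //; exact: gadm_cst.
  rewrite (gexpD d2)//; last exact: gadm_cst.
  by rewrite gexp_cst -/m subrK mulr1.
apply: (gexp_le d2).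
- by apply: gadmZ; apply: gadmD => //; exact: gadm_cst.
- exact: gibbs_gadm (quadratic_cst 1).
- move=> z; rewrite mul1r -[in leRHS](subrK m (ham c Psi g z)) expRD mulrC.
  rewrite ler_wpM2r ?expR_ge0//; apply: le_trans (expR_ge1Dx _).
  by rewrite addrAC -addrA.
Qed.

Lemma gpart_gt0 c Psi g : admissible c Psi -> 0 < gpart c Psi g.
Proof.
by move=> ad; have [L _ HL] := gpart_lb; apply: lt_le_trans (HL _ _ g ad); exact: expR_gt0.
Qed.

Lemma gibbs_exp_gadm c Psi g : admissible c Psi ->
  gadm N d (fun z => expR (e * sumsq N z) * expR (ham c Psi g z)).
Proof.
move=> ad; split.
  apply: seqcontM; last exact/seqcont_expR/seqcont_ham/(adm_cont ad).
  by apply/seqcont_expR/seqcontM; [exact: seqcont_cst|exact: seqcont_sumsq].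
exists (expR (C * (1 + sumsq M g))) => z.
rewrite ger0_norm ?mulr_ge0 ?expR_ge0// -!expRD ler_expR.
apply: le_trans (lerD (lexx _) (adm_ub ad g z)) _.
by rewrite le_eqVlt; apply/orP; left; apply/eqP; rewrite /d; ring.
Qed.

Lemma gint_exp_ub c Psi g : admissible c Psi ->
  gexp N (fun z => expR (e * sumsq N z) * expR (ham c Psi g z)) <=
  expR (C * (1 + sumsq M g)) * gmass d ^+ N.
Proof.
move=> ad; apply: le_trans (ler_norm _) _.
apply: (gexp_bound d2).
  apply: seqcontM; last exact/seqcont_expR/seqcont_ham/(adm_cont ad).
  by apply/seqcont_expR/seqcontM; [exact: seqcont_cst|exact: seqcont_sumsq].
move=> z; rewrite ger0_norm ?mulr_ge0 ?expR_ge0// -!expRD ler_expR.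
apply: le_trans (lerD (lexx _) (adm_ub ad g z)) _.
by rewrite le_eqVlt; apply/orP; left; apply/eqP; rewrite /d; ring.
Qed.

(* x ^+ 2 <= 4 T ^+ 2 when x <= 2 T, and otherwise expR (x - T) >= expR (x / 2) is large *)
Lemma sqr_le_exp (x T : R) : 0 <= x -> 0 <= T ->
  x ^+ 2 <= 4 * T ^+ 2 + 8 * expR (x - T).
Proof.
move=> x0 T0; have [xT|Tx] := leP x (2 * T).
  apply: (@le_trans _ _ (4 * T ^+ 2)); last by rewrite lerDl mulr_ge0// expR_ge0.
  by rewrite (_ : 4 * T ^+ 2 = (2 * T) ^+ 2) ?lerXn2r ?nnegrE ?mulr_ge0//; ring.
have H : expR (x / 2) <= expR (x - T) by rewrite ler_expR; lra.
have := expR_ge1Dxn 1 (divr_ge0 x0 (ler0n _ 2)).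
rewrite expr_div_n (_ : 2`!%:R = 2)// => H2.
have := sqr_ge0 T; move: H H2; set y := expR (x / 2); set w := expR (x - T); lra.
Qed.

(** The quotient of the crude bounds on numerator and denominator would be exponential in
    [sumsq M g]. Instead the exponential moment of [e * sumsq N z] is at most [expR T] with [T]
    linear in [sumsq M g]; since [x^2 <= 4 T^2 + 8 expR (x - T)], the exponential cancels and only a
    multiple of [1 + T^2] remains. *)
Lemma gavg_bound : exists2 L, 0 <= L & forall c Psi f K g, admissible c Psi ->
  quadratic K f -> `|gavg c Psi f g| <= K * L * (1 + sumsq M g) ^+ 2.
Proof.
have [L L0 HL] := gpart_lb.
pose A := C + L + gmass d ^+ N.
have m0 : 0 <= gmass d ^+ N by rewrite exprn_ge0// ltW// gmass_gt0.
have A0 : 0 <= A by rewrite !addr_ge0.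
exists (2 + (8 * A ^+ 2 + 16) / e ^+ 2) => [|c Psi f K g ad qf].
  by rewrite addr_ge0// divr_ge0 ?sqr_ge0// addr_ge0// mulr_ge0// sqr_ge0.
have Z0 := gpart_gt0 g ad.
rewrite /gavg normrM normfV (ger0_norm (ltW Z0)) ler_pdivrMr//.
set G := 1 + sumsq M g; have G1 : 1 <= G by rewrite lerDl sumsq_ge0.
(* In [A], the constant [C] pays for the upper bound on the numerator, [L] for the lower bound on
   the partition function, and [gmass d ^+ N] for the prefactor, through [x <= expR x]. *)
have [T TE] : exists T, T = A * G by exists (A * G).
have T0 : 0 <= T by rewrite TE mulr_ge0// (le_trans ler01).
have expT : gexp N (fun z => expR (e * sumsq N z) * expR (ham c Psi g z)) <=
    expR T * gpart c Psi g.
  apply: le_trans (gint_exp_ub g ad) _; rewrite -/G.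
  apply: (@le_trans _ _ (expR T * expR (- (L * G)))); last by rewrite ler_wpM2l ?expR_ge0 ?HL.
  rewrite -expRD (_ : T - L * G = C * G + gmass d ^+ N * G); last by rewrite TE /A; ring.
  rewrite expRD ler_wpM2l ?expR_ge0//.
  apply: (@le_trans _ _ (gmass d ^+ N * G)); first by rewrite ler_peMr.
  by apply: le_trans (expR_ge1Dx _); rewrite lerDr.
have K0 := quadratic_ge0 qf.
have adE := gibbs_exp_gadm g ad.
have ad1 := gibbs_gadm g ad (quadratic_cst 1).
apply: (@le_trans _ _ (gexp N (fun z => K * (2 + 8 * T ^+ 2 / e ^+ 2) * (1 * expR (ham c Psi g z)) +
   K * (16 / e ^+ 2 * expR (- T)) * (expR (e * sumsq N z) * expR (ham c Psi g z))))).
  apply: (gexp_norm_le d2).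
  - exact: gibbs_gadm qf.
  - by apply: gadmD; exact: gadmZ.
  - move=> z; rewrite normrM (ger0_norm (expR_ge0 _)) mul1r [X in _ <= _ + X]mulrA -mulrDl.
    rewrite ler_wpM2r ?expR_ge0//; apply: (le_trans (qf.2 z)).
    rewrite -!mulrA -mulrDr ler_wpM2l//.
    have r0 := sumsq_ge0 N z.
    have := sqr_le_exp (mulr_ge0 (ltW e0) r0) T0.
    rewrite expRD exprMn -ler_pdivlMl ?exprn_gt0// => H.
    apply: (@le_trans _ _ (2 + 2 * sumsq N z ^+ 2)).
      by have := sqr_ge0 (sumsq N z - 1); lra.
    rewrite -lerBrDl; apply: (le_trans (ler_wpM2l _ H)) => //.
     by rewrite le_eqVlt; apply/orP; left; apply/eqP; ring.
rewrite (gexpD d2); [|exact: gadmZ|exact: gadmZ].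
rewrite (gexpZ d2 _ ad1) (gexpZ d2 _ adE).
rewrite -/(gpart c Psi g).
apply: (@le_trans _ _ (K * (2 + 8 * T ^+ 2 / e ^+ 2) * gpart c Psi g +
  K * (16 / e ^+ 2 * expR (- T)) * (expR T * gpart c Psi g))).
  rewrite lerD2l; apply: ler_wpM2l => //.
  by apply: mulr_ge0 => //; apply: mulr_ge0; [apply: divr_ge0 => //; exact: sqr_ge0|exact: expR_ge0].
rewrite (_ : K * (16 / e ^+ 2 * expR (- T)) * (expR T * gpart c Psi g) =
   K * (16 / e ^+ 2) * (expR T * expR (- T)) * gpart c Psi g); last by ring.
rewrite expRxMexpNx_1 mulr1 -mulrDl; apply: ler_wpM2r; first exact: ltW.
rewrite -mulrDr -[leRHS]mulrA; apply: ler_wpM2l => //.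
have G2 : 1 <= G ^+ 2 by rewrite expr_ge1// (le_trans ler01).
rewrite (_ : _ * G ^+ 2 = 2 * G ^+ 2 + 8 * T ^+ 2 / e ^+ 2 + 16 / e ^+ 2 * G ^+ 2); last first.
  by rewrite TE; ring.
apply: lerD; first by rewrite lerD2r ler_peMr.
by rewrite ler_peMr// divr_ge0// sqr_ge0.
Qed.

Lemma cvg_gavg (c_ : nat -> nat -> R) c (Psi_ : nat -> seq R -> R) Psi (g_ : nat -> seq R) g f K :
  (forall m, admissible (c_ m) (Psi_ m)) -> admissible c Psi -> quadratic K f ->
  (forall k, (k < M)%N -> c_ m k @[m --> \oo] --> c k) ->
  (forall z, Psi_ m z @[m --> \oo] --> Psi z) -> seqcvg M g_ g ->
  gavg (c_ m) (Psi_ m) f (g_ m) @[m --> \oo] --> gavg c Psi f g.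
Proof.
move=> ad_ ad qf cc PP gg; apply: cvg_seqM; first exact: cvg_gint qf cc PP gg.
apply: cvgV; first by rewrite gt_eqF// gpart_gt0.
exact: cvg_gint (quadratic_cst 1) cc PP gg.
Qed.

Lemma seqcont_gavg c Psi f K : admissible c Psi -> quadratic K f ->
  seqcont M (gavg c Psi f).
Proof.
move=> ad qf g_ g gg; apply: (cvg_gavg _ ad qf) => // [k _|z]; exact: cvg_cst.
Qed.

Lemma cvg_ln_gpart (c_ : nat -> nat -> R) c (Psi_ : nat -> seq R -> R) Psi (g_ : nat -> seq R) g :
  (forall m, admissible (c_ m) (Psi_ m)) -> admissible c Psi ->
  (forall k, (k < M)%N -> c_ m k @[m --> \oo] --> c k) ->
  (forall z, Psi_ m z @[m --> \oo] --> Psi z) -> seqcvg M g_ g ->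
  ln (gpart (c_ m) (Psi_ m) (g_ m)) @[m --> \oo] --> ln (gpart c Psi g).
Proof.
move=> ad_ ad cc PP gg; apply: (cvg_comp _ (@ln R)).
  exact: cvg_gint (quadratic_cst 1) cc PP gg.
by apply: continuous_ln; exact: gpart_gt0.
Qed.

(** Both bounds on the partition function are exponentials of [sumsq M g], so its logarithm grows
    linearly and can be integrated over the disorder however large [C] is. *)
Lemma ln_gpart_bound : exists2 L, 0 <= L & forall c Psi g, admissible c Psi ->
  `|ln (gpart c Psi g)| <= L * (1 + sumsq M g).
Proof.
have [L L0 HL] := gpart_lb.
have m0 : 0 <= gmass d ^+ N by rewrite exprn_ge0// ltW// gmass_gt0.
exists (L + (C + gmass d ^+ N)) => [|c Psi g ad]; first by rewrite !addr_ge0.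
have Z0 := gpart_gt0 g ad.
set G := 1 + sumsq M g; have G1 : 1 <= G by rewrite lerDl sumsq_ge0.
have G0 : 0 <= G by rewrite (le_trans ler01).
have lb : - (L * G) <= ln (gpart c Psi g).
  by rewrite -[leLHS]expRK ler_ln ?posrE ?expR_gt0// HL.
have ub : ln (gpart c Psi g) <= (C + gmass d ^+ N) * G.
  rewrite -[leRHS]expRK ler_ln ?posrE ?expR_gt0//.
  apply: le_trans (_ : expR (C * G) * gmass d ^+ N <= _); last first.
    rewrite mulrDl expRD ler_wpM2l ?expR_ge0//.
    apply: (@le_trans _ _ (gmass d ^+ N * G)); first by rewrite ler_peMr.
    by apply: le_trans (expR_ge1Dx _); rewrite lerDr.
  apply: le_trans (gint_exp_ub g ad); apply: (gexp_le d2).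
  - exact: gibbs_gadm (quadratic_cst 1).
  - exact: gibbs_exp_gadm.
  - move=> z; rewrite ler_wpM2r ?expR_ge0// -[leLHS]expR0 ler_expR mulr_ge0 ?sumsq_ge0//.
    exact: ltW.
have LG : 0 <= L * G by rewrite mulr_ge0.
have CG : 0 <= (C + gmass d ^+ N) * G by rewrite mulr_ge0// addr_ge0.
rewrite mulrDl ler_norml; apply/andP; split; move: lb ub; lra.
Qed.

Lemma seqcont_ln_gpart c Psi : admissible c Psi ->
  seqcont M (fun g => ln (gpart c Psi g)).
Proof. by move=> ad g_ g gg; apply: cvg_ln_gpart => // *; exact: cvg_cst. Qed.

Lemma gavg_sqr_bound K (h : seq R -> R) :
  (forall g, `|h g| <= K * (1 + sumsq M g) ^+ 2) ->
  forall g, `|h g ^+ 2| <= K ^+ 2 * (1 + sumsq M g) ^+ 4.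
Proof.
move=> hK g.
have -> : (1 + sumsq M g) ^+ 4 = ((1 + sumsq M g) ^+ 2) ^+ 2 by rewrite -exprM.
by rewrite normrX -exprMn lerXn2r ?nnegrE// (le_trans (normr_ge0 _) (hK g)).
Qed.

(** Once everything is polynomial in the disorder, any exponent in []0, 1/2[] would do for the outer
    integral; 1/4 is fixed from here on. *)
Lemma poly_gdom k : exists2 L, 0 < L & forall K (h : seq R -> R), 0 <= K ->
  (forall g, `|h g| <= K * (1 + sumsq M g) ^+ k) -> gdom M (1 / 4) (K * L) h.
Proof.
have [L L0 HL] := @poly_le_expR R k (1 / 4) ltac:(lra).
exists L => // K h K0 hK g; apply: (le_trans (hK g)); rewrite -mulrA.
by rewrite ler_wpM2l// HL// sumsq_ge0.
Qed.

Lemma poly_gadm k K (h : seq R -> R) : 0 <= K -> seqcont M h ->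
  (forall g, `|h g| <= K * (1 + sumsq M g) ^+ k) -> gadm M (1 / 4) h.
Proof.
move=> K0 ch hK; split=> //; have [L _ HL] := poly_gdom k.
by exists (K * L); exact: HL.
Qed.

Lemma gadm_gavg c Psi f K : admissible c Psi -> quadratic K f ->
  gadm M (1 / 4) (gavg c Psi f).
Proof.
move=> ad qf; have [L L0 HL] := gavg_bound.
apply: (@poly_gadm 2 (K * L)); first by rewrite mulr_ge0// (quadratic_ge0 qf).
  exact: seqcont_gavg qf.
by move=> g; exact: HL qf.
Qed.

Lemma gadm_gavg_sqr c Psi f K : admissible c Psi -> quadratic K f ->
  gadm M (1 / 4) (fun g => gavg c Psi f g ^+ 2).
Proof.
move=> ad qf; have [L L0 HL] := gavg_bound.
apply: (@poly_gadm 4 ((K * L) ^+ 2)); first exact: sqr_ge0.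
  by apply: seqcontX; exact: seqcont_gavg qf.
by apply: gavg_sqr_bound => g; exact: HL qf.
Qed.

(** * Integration by parts in one disorder variable *)

Section DisorderDerivative.
Variables (c : nat -> R) (Psi : seq R -> R) (k : nat).
Hypothesis ad : admissible c Psi.
Hypothesis kM : (k < M)%N.

Lemma ham_set_nth g y z :
  ham c Psi (set_nth 0 g k y) z = ham c Psi (set_nth 0 g k 0) z + c k * phi k z * y.
Proof.
rewrite /ham (bigD1 (Ordinal kM))//= [X in _ = X + _ + _](bigD1 (Ordinal kM))//=.
rewrite (eq_bigr (fun i : 'I_M => c i * zc (set_nth 0 g k 0) i * phi i z)); last first.
  move=> i ik; rewrite /zc !nth_set_nth /=.
  by have /negbTE -> : (i != k :> nat) by [].
by rewrite /zc !nth_set_nth /= eqxx; ring.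
Qed.

Lemma sumsq_set_nth g y : sumsq M (set_nth 0 g k y) = sumsq M (set_nth 0 g k 0) + y ^+ 2.
Proof.
rewrite /sumsq (bigD1 (Ordinal kM))//= [X in _ = X + _](bigD1 (Ordinal kM))//=.
rewrite (eq_bigr (fun i : 'I_M => zc (set_nth 0 g k 0) i ^+ 2)); last first.
  move=> i ik; rewrite /zc !nth_set_nth /=.
  by have /negbTE -> : (i != k :> nat) by [].
by rewrite /zc !nth_set_nth /= eqxx; ring.
Qed.

Lemma gint_derive f K K' g y : quadratic K f ->
  quadratic K' (fun z => c k * phi k z * f z) ->
  is_derive y 1 (fun y => gint c Psi f (set_nth 0 g k y))
    (gint c Psi (fun z => c k * phi k z * f z) (set_nth 0 g k y)).
Proof.
move=> qf qf'; have [L L0 HL] := gibbs_dom.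
have K'0 := quadratic_ge0 qf'.
apply: (@gexp_derive _ N d (K' * L * expR (C * (1 + (sumsq M (set_nth 0 g k 0) + (`|y| + 1) ^+ 2))))
  (fun y z => f z * expR (ham c Psi (set_nth 0 g k y) z))
  (fun y z => c k * phi k z * f z * expR (ham c Psi (set_nth 0 g k y) z)) y 1) => //.
- by move=> x _; exact: gibbs_gadm qf.
- exact: (gibbs_gadm _ ad qf').1.
- move=> x z _.
  pose h := fun y : R => ham c Psi (set_nth 0 g k 0) z + c k * phi k z * y.
  have -> : (fun y => f z * expR (ham c Psi (set_nth 0 g k y) z)) = f z \*: (expR \o h).
    by apply/funext => w /=; rewrite ham_set_nth.
  rewrite ham_set_nth -/(h x).
  have H : is_derive x 1 h (c k * phi k z).
    have -> : h = cst (ham c Psi (set_nth 0 g k 0) z) + (c k * phi k z) \*: (id : R -> R) by [].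
    by apply: is_derive_eq; rewrite add0r /GRing.scale /= mulr1.
  have H2 := @is_derive1_comp _ expR h x _ _ (is_derive_expR _) H.
  by apply: is_derive_eq; rewrite /= /GRing.scale /=; ring.
- move=> x yx; apply: gdom_le (HL _ _ _ _ _ ad qf') _.
  rewrite ler_wpM2l ?mulr_ge0 ?(ltW L0)// ler_expR ler_wpM2l// lerD2l sumsq_set_nth lerD2l.
  rewrite -[x ^+ 2]real_normK ?num_real// lerXn2r ?nnegrE ?addr_ge0//.
  have := ler_normD (x - y) y; rewrite subrK; move: yx; lra.
Qed.

Lemma quadratic_phi : quadratic 1 (phi k).
Proof.
split; first exact: phi_cont.
move=> z; rewrite mul1r (le_trans (phi_bound kM z))// expr2 ler_peMr ?lerDl ?addr_ge0 ?sumsq_ge0//.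
Qed.

Lemma quadratic_phi2 : quadratic 1 (fun z => phi k z ^+ 2).
Proof.
split; first by apply: seqcontX; exact: phi_cont.
move=> z; rewrite mul1r normrX lerXn2r ?nnegrE ?addr_ge0 ?sumsq_ge0//.
exact: phi_bound.
Qed.

Lemma quadraticZ a K f : quadratic K f -> quadratic (`|a| * K) (fun z => a * f z).
Proof.
move=> [cf fK]; split; first by apply: seqcontM => //; exact: seqcont_cst.
by move=> z; rewrite normrM -mulrA ler_wpM2l.
Qed.

(** [ham] is affine in the [k]-th disorder variable with slope [c k * phi k], so the quotient rule
    produces the Gibbs variance of [phi k]. *)
Lemma gavg_derive g y :
  is_derive y 1 (fun y => gavg c Psi (phi k) (set_nth 0 g k y))
    (c k * (gavg c Psi (fun z => phi k z ^+ 2) (set_nth 0 g k y) -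
            gavg c Psi (phi k) (set_nth 0 g k y) ^+ 2)).
Proof.
have E1 : (fun z => c k * phi k z * 1) = (fun z => c k * phi k z).
  by apply/funext => z; rewrite mulr1.
have E2 : (fun z => c k * phi k z * phi k z) = (fun z => c k * phi k z ^+ 2).
  by apply/funext => z; rewrite -mulrA -expr2.
have q1 := quadraticZ (c k) quadratic_phi; have q2 := quadraticZ (c k) quadratic_phi2.
have D1 := @gint_derive (fun=> 1) _ _ g y (quadratic_cst 1) ltac:(rewrite E1; exact: q1).
have D2 := @gint_derive (phi k) _ _ g y quadratic_phi ltac:(rewrite E2; exact: q2).
rewrite E1 in D1; rewrite E2 in D2.
set s := set_nth 0 g k y.
have Z0 : gint c Psi (fun=> 1) s != 0 by rewrite gt_eqF//; exact: gpart_gt0.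
have D3 := is_deriveV Z0 D1.
have -> : (fun y => gavg c Psi (phi k) (set_nth 0 g k y)) =
  (fun y => gint c Psi (phi k) (set_nth 0 g k y)) *
  (fun y => (gint c Psi (fun=> 1) (set_nth 0 g k y))^-1) by [].
have GZ f K : quadratic K f -> gint c Psi (fun z => c k * f z) s = c k * gint c Psi f s.
  move=> qf; rewrite /gint -(gexpZ d2); last exact: gibbs_gadm qf.
  by congr gexp; apply/funext => z; rewrite mulrA.
apply: is_derive_eq; rewrite /GRing.scale /= -/s (GZ _ _ quadratic_phi) (GZ _ _ quadratic_phi2).
by rewrite /gavg /gpart; field.
Qed.

Lemma gauss_disorder_ibp :
  gexp M (fun g => zc g k * gavg c Psi (phi k) g) =
  c k * gexp M (fun g => gavg c Psi (fun z => phi k z ^+ 2) g - gavg c Psi (phi k) g ^+ 2).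
Proof.
have a1 := gadm_gavg ad quadratic_phi.
have a2 := gadmB (gadm_gavg ad quadratic_phi2) (gadm_gavg_sqr ad quadratic_phi).
have q4 : 1 / 4 < 1 / 2 :> R by lra.
rewrite -(gexpZ q4)//; apply: (gexp_ibp q4) => //; first exact: gadmZ.
by move=> s y; exact: gavg_derive.
Qed.

End DisorderDerivative.

Lemma cvg_gexp_gavg_sqr (c_ : nat -> nat -> R) c (Psi_ : nat -> seq R -> R) Psi k :
  (forall m, admissible (c_ m) (Psi_ m)) -> admissible c Psi -> (k < M)%N ->
  (forall k, (k < M)%N -> c_ m k @[m --> \oo] --> c k) ->
  (forall z, Psi_ m z @[m --> \oo] --> Psi z) ->
  gexp M (fun g => gavg (c_ m) (Psi_ m) (phi k) g ^+ 2) @[m --> \oo] -->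
  gexp M (fun g => gavg c Psi (phi k) g ^+ 2).
Proof.
move=> ad_ ad kM cc PP; have [L L0 HL] := gavg_bound; have [L' _ HL'] := poly_gdom 4.
have qk := quadratic_phi kM; have q4 : 1 / 4 < 1 / 2 :> R by lra.
apply: (gexp_cvg (d := 1 / 4) (K := L ^+ 2 * L')) => // [m||m|g].
- by apply: seqcontX; exact: seqcont_gavg (ad_ m) qk.
- by apply: seqcontX; exact: seqcont_gavg ad qk.
- apply: HL'; first exact: sqr_ge0.
  by apply: gavg_sqr_bound => g; rewrite -[L]mul1r; exact: HL qk.
- by apply: cvg_seqX; apply: cvg_gavg qk cc PP _ => //; exact: seqcvg_cst.
Qed.

Lemma cvg_gexp_ln_gpart (c_ : nat -> nat -> R) c (Psi_ : nat -> seq R -> R) Psi :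
  (forall m, admissible (c_ m) (Psi_ m)) -> admissible c Psi ->
  (forall k, (k < M)%N -> c_ m k @[m --> \oo] --> c k) ->
  (forall z, Psi_ m z @[m --> \oo] --> Psi z) ->
  gexp M (fun g => ln (gpart (c_ m) (Psi_ m) g)) @[m --> \oo] -->
  gexp M (fun g => ln (gpart c Psi g)).
Proof.
move=> ad_ ad cc PP; have [L L0 HL] := ln_gpart_bound; have [L' _ HL'] := poly_gdom 1.
have q4 : 1 / 4 < 1 / 2 :> R by lra.
apply: (gexp_cvg (d := 1 / 4) (K := L * L')) => // [m||m|g].
- exact: seqcont_ln_gpart.
- exact: seqcont_ln_gpart.
- by apply: HL' => // g; rewrite expr1; exact: HL.
- by apply: cvg_ln_gpart => //; exact: seqcvg_cst.
Qed.

(** * Derivative of the mean log-partition function along a path of Hamiltonians *)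

Section Path.
Variables (c_ c' : R -> nat -> R) (Psi_ Psi' : R -> seq R -> R).
Hypothesis ad : forall t, admissible (c_ t) (Psi_ t).
Hypothesis c'_bound : forall t k, (k < M)%N -> `|c' t k| <= C.
Hypothesis Psi'_quad : forall t, quadratic C (Psi' t).
Hypothesis dc : forall t k, (k < M)%N -> is_derive t 1 (fun u => c_ u k) (c' t k).
Hypothesis dPsi : forall t z, is_derive t 1 (fun u => Psi_ u z) (Psi' t z).

Lemma quadratic_ham t g : quadratic (C * M.+1%:R * (1 + sumsq M g)) (ham (c' t) (Psi' t) g).
Proof.
split; first exact/seqcont_ham/(Psi'_quad t).1.
by move=> z; apply: ham_bound; [exact: c'_bound|exact: (Psi'_quad t).2].
Qed.

Lemma ham_derive g z t :
  is_derive t 1 (fun u => ham (c_ u) (Psi_ u) g z) (ham (c' t) (Psi' t) g z).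
Proof.
have -> : (fun u => ham (c_ u) (Psi_ u) g z) =
   \sum_(k < M) ((zc g k * phi k z) \*: (fun u => c_ u k : R)) + (fun u => Psi_ u z).
  apply/funext => u; rewrite /ham fctE fct_sumE; congr (_ + _).
  by apply: eq_bigr => k _; rewrite /= /GRing.scale /=; ring.
rewrite /ham (eq_bigr (fun k : 'I_M => (zc g k * phi k z) *: c' t k)); last first.
  by move=> k _; rewrite /GRing.scale /=; ring.
apply: is_deriveD; apply: is_derive_sum => k.
by apply: is_deriveZ; exact: dc.
Qed.

Lemma gpart_path_derive g t : is_derive t 1 (fun u => gpart (c_ u) (Psi_ u) g)
  (gint (c_ t) (Psi_ t) (ham (c' t) (Psi' t) g) g).
Proof.
have [L L0 HL] := gibbs_dom.
apply: (@gexp_derive _ N d (C * M.+1%:R * (1 + sumsq M g) * L * expR (C * (1 + sumsq M g)))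
  (fun u z => 1 * expR (ham (c_ u) (Psi_ u) g z))
  (fun u z => ham (c' u) (Psi' u) g z * expR (ham (c_ u) (Psi_ u) g z)) t 1) => //.
- by move=> u _; exact: gibbs_gadm (quadratic_cst 1).
- exact: (gibbs_gadm g (ad t) (quadratic_ham t g)).1.
- move=> u z _.
  have -> : (fun u => 1 * expR (ham (c_ u) (Psi_ u) g z)) = expR \o (fun u => ham (c_ u) (Psi_ u) g z).
    by apply/funext => w; rewrite mul1r.
  have := @is_derive1_comp _ expR _ u _ _ (is_derive_expR _) (ham_derive g z u).
  by rewrite mulrC.
- by move=> u _; apply: HL (ad u) _; exact: quadratic_ham.
Qed.

(** The disorder variables are constants for the Gibbs measure; pulling them out creates the
    products [zc g k * gavg] to which integration by parts applies. *)
Lemma gavg_ham g t : gavg (c_ t) (Psi_ t) (ham (c' t) (Psi' t) g) g =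
  \sum_(k < M) c' t k * (zc g k * gavg (c_ t) (Psi_ t) (phi k) g) +
  gavg (c_ t) (Psi_ t) (Psi' t) g.
Proof.
have gk (k : 'I_M) : gadm N d (fun z => c' t k * zc g k *
    (phi k z * expR (ham (c_ t) (Psi_ t) g z))).
  by apply: gadmZ; exact: gibbs_gadm (quadratic_phi (ltn_ord k)).
rewrite /gavg [X in X / _](_ : _ = \sum_(k < M) c' t k * (zc g k * gint (c_ t) (Psi_ t) (phi k) g) +
  gint (c_ t) (Psi_ t) (Psi' t) g).
  rewrite mulrDl mulr_suml; congr (_ + _).
  by apply: eq_bigr => k _; rewrite !mulrA.
rewrite {1}/gint (_ : (fun z => _) = (fun z => \sum_(k < M) c' t k * zc g k *
    (phi k z * expR (ham (c_ t) (Psi_ t) g z)) + Psi' t z * expR (ham (c_ t) (Psi_ t) g z))).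
  rewrite (gexpD d2); [|exact: gadm_sum|exact: gibbs_gadm (Psi'_quad t)].
  rewrite (gexp_sum d2)//; congr (_ + _); apply: eq_bigr => k _.
  by rewrite (gexpZ d2) ?mulrA//; exact: gibbs_gadm (quadratic_phi (ltn_ord k)).
apply/funext => z; rewrite {1}/ham mulrDl mulr_suml; congr (_ + _).
by apply: eq_bigr => k _; rewrite !mulrA.
Qed.

Lemma ln_gpart_derive g t : is_derive t 1 (fun u => ln (gpart (c_ u) (Psi_ u) g))
  (gavg (c_ t) (Psi_ t) (ham (c' t) (Psi' t) g) g).
Proof.
have Z0 := gpart_gt0 g (ad t).
have := @is_derive1_comp _ (@ln R) _ t _ _ (is_derive1_ln Z0) (gpart_path_derive g t).
by rewrite mulrC.
Qed.

Lemma gexp_ln_gpart_derive t :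
  is_derive t 1 (fun u => gexp M (fun g => ln (gpart (c_ u) (Psi_ u) g)))
  (\sum_(k < M) c_ t k * c' t k *
     gexp M (fun g => gavg (c_ t) (Psi_ t) (fun z => phi k z ^+ 2) g -
                      gavg (c_ t) (Psi_ t) (phi k) g ^+ 2)
   + gexp M (gavg (c_ t) (Psi_ t) (Psi' t))).
Proof.
have q4 : 1 / 4 < 1 / 2 :> R by lra.
have q0 : 0 <= 1 / 4 :> R by lra.
have [L L0 HL] := ln_gpart_bound; have [L1 L10 HL1] := gavg_bound.
(* Degree 3: one power from the growth of the derivative of [ham] in the disorder, two from
   [gavg_bound]. *)
have [L2 L20 HL2] := poly_gdom 3.
have gk (k : 'I_M) : gadm M (1 / 4) (fun g => zc g k * gavg (c_ t) (Psi_ t) (phi k) g).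
  apply: (@poly_gadm 3 L1) => //.
    by apply: seqcontM; [exact: seqcont_zc|exact: seqcont_gavg (quadratic_phi (ltn_ord k))].
  move=> g; rewrite normrM exprS mulrCA ler_pM// ?norm_zc_le//.
  by have := HL1 _ _ _ _ g (ad t) (quadratic_phi (ltn_ord k)); rewrite mul1r.
have E : gexp M (fun g => gavg (c_ t) (Psi_ t) (ham (c' t) (Psi' t) g) g) =
  \sum_(k < M) c_ t k * c' t k *
     gexp M (fun g => gavg (c_ t) (Psi_ t) (fun z => phi k z ^+ 2) g -
                      gavg (c_ t) (Psi_ t) (phi k) g ^+ 2)
   + gexp M (gavg (c_ t) (Psi_ t) (Psi' t)).
  under eq_fun do rewrite gavg_ham.
  rewrite (gexpD q4); last exact: gadm_gavg (ad t) (Psi'_quad t).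
    rewrite (gexp_sum q4)//; last by move=> k; exact: gadmZ.
    congr (_ + _); apply: eq_bigr => k _.
    by rewrite (gexpZ q4)// gauss_disorder_ibp// mulrA [c' t k * _]mulrC.
  by apply: gadm_sum => // k; exact: gadmZ.
rewrite -E.
apply: (@gexp_derive _ M (1 / 4) (C * M.+1%:R * L1 * L2)
  (fun u g => ln (gpart (c_ u) (Psi_ u) g))
  (fun u g => gavg (c_ u) (Psi_ u) (ham (c' u) (Psi' u) g) g) t 1) => //.
- move=> u _; apply: (@poly_gadm 1 L) => //; first exact: seqcont_ln_gpart.
  by move=> g; rewrite expr1; exact: HL.
- under eq_fun do rewrite gavg_ham.
  apply: seqcontD; last exact: seqcont_gavg (ad t) (Psi'_quad t).
  by apply: seqcont_sum => k; apply: seqcontM; [exact: seqcont_cst|exact: (gk k).1].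
- by move=> u g _; exact: ln_gpart_derive.
- move=> u _; apply: HL2; first by rewrite !mulr_ge0.
  move=> g; apply: le_trans (HL1 _ _ _ _ g (ad u) (quadratic_ham u g)) _.
  by rewrite le_eqVlt; apply/orP; left; apply/eqP; rewrite exprS; ring.
Qed.

End Path.

End Gibbs.

(** * The replica-symmetric interpolation *)

Section ReplicaSymmetric.
Variables (R : realType) (beta lam qbar : R) (N : nat).
Hypothesis beta_gt0 : 0 < beta.
Hypothesis qbar_ge0 : 0 <= qbar.
Hypothesis kappa_gt0 : 0 < 1 - lam + beta ^+ 2 * qbar.
Hypothesis N_gt0 : (0 < N)%N.
Implicit Types (a b t y : R) (g z J : seq R).

Local Notation M := (N * N + N)%N.
Let kappa := 1 - lam + beta ^+ 2 * qbar.
Let bs := beta * Num.sqrt qbar.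
Let bj := beta / Num.sqrt (2 * N%:R).

Let N1 : 1 <= N%:R :> R. Proof. by rewrite ler1n. Qed.
Let N0 : 0 < N%:R :> R. Proof. by rewrite ltr0n. Qed.
Let N4 : 0 < 4 * N%:R :> R. Proof. by rewrite mulr_gt0. Qed.
Let bN0 : 0 <= beta ^+ 2 / (4 * N%:R).
Proof. by apply: divr_ge0; [exact: sqr_ge0|exact: ltW]. Qed.
Let bN_le : 1 * (beta ^+ 2 / (4 * N%:R)) <= beta ^+ 2.
Proof. by rewrite mul1r ler_pdivrMr// ler_peMr ?sqr_ge0//; move: N1; lra. Qed.
Let bs0 : 0 <= bs. Proof. by rewrite mulr_ge0 ?sqrtr_ge0// ltW. Qed.
Let bs2 : bs ^+ 2 = beta ^+ 2 * qbar. Proof. by rewrite exprMn sqr_sqrtr. Qed.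
Let bj0 : 0 <= bj. Proof. by rewrite divr_ge0 ?sqrtr_ge0// ltW. Qed.
Let bj2 : bj ^+ 2 = beta ^+ 2 / (2 * N%:R).
Proof. by rewrite exprMn exprVn sqr_sqrtr// mulr_ge0. Qed.
Let bj_le : bj <= beta.
Proof.
rewrite ler_pdivrMr ?sqrtr_gt0 ?mulr_gt0// ler_peMr ?(ltW beta_gt0)//.
by rewrite -[leLHS]sqrtr1 ler_sqrt ?mulr_ge0//; move: N1; lra.
Qed.

(* The disorder is one list: the N * N couplings J, then the N external fields J'. *)
Definition spin k z : R :=
  if (k < N * N)%N then zc z (k %/ N) * zc z (k %% N) else zc z (k - N * N).
(** [a] and [b] stand for the square roots of [t] and [1 - t], that is for [sin] and [cos] of the
    angle. Linearity in the pair is what lets [coef] also express its own derivative, at [cos] and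
    [- sin]. *)
Definition coef a b k : R := if (k < N * N)%N then bj * a else bs * b.
Definition pot a b z : R := - (a ^+ 2 * beta ^+ 2 / (4 * N%:R)) * sumsq N z ^+ 2 +
  (b ^+ 2 * - (beta ^+ 2 * qbar) / 2 + lam / 2) * sumsq N z.

(** The external field costs [2 * e] and the target [1 / 2 - 2 * e] as much again, against a
    quadratic coefficient [(1 - kappa) / 2]: this asks for [8 * e <= kappa]. The minimum with 1
    ensures [e <= 1 / 8]. *)
Let e := Num.min kappa 1 / 8.
Let e0 : 0 < e. Proof. by rewrite divr_gt0// lt_min kappa_gt0 ltr01. Qed.
Let e8 : e <= 1 / 8. Proof. by rewrite ler_pM2r ?invr_gt0// ge_min lexx orbT. Qed.
Let ek : 8 * e <= kappa.
Proof. by rewrite /e mulrC divfK// ge_min lexx. Qed.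

(** A sum of separate bounds: 1 and [bs ^+ 2 / (8 * e)] multiply the squared couplings and fields in
    [ham_ub], the third term bounds the completed square there, and the others bound [coef], [pot]
    and [dpot]. *)
Let C := 1 + bs ^+ 2 / (8 * e) + beta ^+ 2 * qbar ^+ 2 * N%:R + beta + bs +
  beta ^+ 2 + beta ^+ 2 * qbar + `|lam|.

Let bq0 : 0 <= beta ^+ 2 * qbar. Proof. by rewrite mulr_ge0// sqr_ge0. Qed.
Let bqq0 : 0 <= beta ^+ 2 * qbar ^+ 2 * N%:R.
Proof. by apply: mulr_ge0; [apply: mulr_ge0; exact: sqr_ge0|exact: ltW]. Qed.
Let bse0 : 0 <= bs ^+ 2 / (8 * e).
Proof. by rewrite divr_ge0 ?sqr_ge0// mulr_ge0// ltW. Qed.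
Let C0 : 0 <= C.
Proof. by rewrite !addr_ge0 ?sqr_ge0// ltW. Qed.

Lemma spin_cont k : (k < M)%N -> seqcont N (spin k).
Proof.
move=> kM; rewrite /spin; case: ltnP => kN; last first.
  by apply: seqcont_zc; rewrite ltn_subLR.
by apply: seqcontM; apply: seqcont_zc; rewrite ?ltn_pmod// ltn_divLR.
Qed.

Lemma spin_bound k : (k < M)%N -> forall z, `|spin k z| <= 1 + sumsq N z.
Proof.
have zcle z i : (i < N)%N -> zc z i ^+ 2 <= sumsq N z.
  move=> iN; rewrite /sumsq (bigD1 (Ordinal iN))//= lerDl.
  by apply: sumr_ge0 => j _; exact: sqr_ge0.
move=> kM z; rewrite /spin; case: ltnP => kN; last first.
  by apply: norm_zc_le; rewrite ltn_subLR.
have i1 : (k %/ N < N)%N by rewrite ltn_divLR.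
have i2 : (k %% N < N)%N by rewrite ltn_pmod.
have := zcle z _ i1; have := zcle z _ i2.
set x := zc z _; set y := zc z _; set r := sumsq N z => H1 H2.
have := sqr_ge0 (x - y); have := sqr_ge0 (x + y) => H3 H4.
by rewrite ler_norml; apply/andP; split; move: H1 H2 H3 H4; nra.
Qed.

Lemma idxJ (i j : 'I_N) : (i * N + j < N * N)%N.
Proof.
by rewrite (@leq_trans (i.+1 * N))// ?leq_mul2r ?ltn_ord ?orbT// mulSn addnC ltn_add2r.
Qed.

Lemma spinJ (i j : 'I_N) z : spin (i * N + j) z = zc z i * zc z j.
Proof.
by rewrite /spin idxJ divnMDl// divn_small// addn0 modnMDl modn_small.
Qed.

Lemma spinH (i : 'I_N) z : spin (N * N + i) z = zc z i.
Proof. by rewrite /spin ltnNge leq_addr /= addKn. Qed.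

Lemma sum_mulord (m n : nat) (F : nat -> R) :
  \sum_(k < m * n) F k = \sum_(i < m) \sum_(j < n) F (i * n + j)%N.
Proof.
elim: m => [|m IH]; first by rewrite !big_ord0.
by rewrite mulSnr big_split_ord big_ord_recr IH.
Qed.

Lemma sum_disorder (F : nat -> R) : \sum_(k < M) F k =
  \sum_(i < N) \sum_(j < N) F (i * N + j)%N + \sum_(i < N) F (N * N + i)%N.
Proof. by rewrite big_split_ord -sum_mulord. Qed.

Lemma coefJ a b (i j : 'I_N) : coef a b (i * N + j) = bj * a.
Proof.
by rewrite /coef idxJ.
Qed.

Lemma coefH a b (i : 'I_N) : coef a b (N * N + i) = bs * b.
Proof. by rewrite /coef ltnNge leq_addr. Qed.

Lemma sumsq_sqr z : sumsq N z ^+ 2 = \sum_(i < N) \sum_(j < N) (zc z i * zc z j) ^+ 2.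
Proof.
rewrite expr2 /sumsq big_distrlr; apply: eq_bigr => i _; apply: eq_bigr => j _.
by rewrite exprMn.
Qed.

(** The couplings are traded for their squares plus half of the quartic confinement, the fields for
    their squares plus [2 * e * sumsq N z]; the other half of the quartic term handles what
    [b^2 = 1 - a^2] adds to the quadratic coefficient. *)
Lemma ham_ub a b g z : a ^+ 2 + b ^+ 2 = 1 -> ham M spin (coef a b) (pot a b) g z <=
  C * (1 + sumsq M g) + (1 / 2 - 2 * e) * sumsq N z.
Proof.
move=> ab1; have a0 := sqr_ge0 a; have b0 := sqr_ge0 b.
have r0 := sumsq_ge0 N z.
(* The weight 1 on the squared couplings makes the price [(bj a)^2 / 4], exactly half of the quartic
   coefficient of [pot]. *)
have sJ : \sum_(i < N) \sum_(j < N) bj * a * zc g (i * N + j) * (zc z i * zc z j) <=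
    \sum_(i < N) \sum_(j < N) zc g (i * N + j) ^+ 2 +
    beta ^+ 2 * a ^+ 2 / (8 * N%:R) * sumsq N z ^+ 2.
  rewrite sumsq_sqr mulr_sumr -big_split; apply: ler_sum => i _.
  rewrite mulr_sumr -big_split; apply: ler_sum => j _ /=.
  rewrite (_ : beta ^+ 2 * a ^+ 2 / (8 * N%:R) = (bj * a) ^+ 2 / 4); last first.
    by rewrite exprMn bj2; field; rewrite gt_eqF.
  set x := zc g _; set y := zc z i * zc z j.
  by have := sqr_ge0 (x - bj * a * y / 2); nra.
have sH : \sum_(i < N) bs * b * zc g (N * N + i) * zc z i <=
    bs ^+ 2 / (8 * e) * \sum_(i < N) zc g (N * N + i) ^+ 2 + 2 * e * sumsq N z.
  rewrite /sumsq !mulr_sumr -big_split; apply: ler_sum => i _ /=.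
  set x := zc g _; set y := zc z i.
  apply: (@le_trans _ _ (bs ^+ 2 / (8 * e) * (b ^+ 2 * x ^+ 2) + 2 * e * y ^+ 2)); last first.
    rewrite lerD2r ler_wpM2l// ler_piMl ?sqr_ge0//; move: ab1 a0; lra.
  rewrite -subr_ge0 (_ : _ - _ = 2 * e * (y - bs * b * x / (4 * e)) ^+ 2).
    by rewrite mulr_ge0 ?sqr_ge0// mulr_ge0// ltW.
  by field; rewrite gt_eqF.
rewrite /ham (sum_disorder (fun k => coef a b k * zc g k * spin k z)).
under eq_bigr do under eq_bigr do rewrite coefJ spinJ.
under [X in _ + X + _]eq_bigr do rewrite coefH spinH.
have GE : sumsq M g = \sum_(i < N) \sum_(j < N) zc g (i * N + j) ^+ 2 +
   \sum_(i < N) zc g (N * N + i) ^+ 2.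
  by rewrite /sumsq (sum_disorder (fun k => zc g k ^+ 2)).
have GJ0 : 0 <= \sum_(i < N) \sum_(j < N) zc g (i * N + j) ^+ 2.
  by apply: sumr_ge0 => i _; apply: sumr_ge0 => j _; exact: sqr_ge0.
have GH0 : 0 <= \sum_(i < N) zc g (N * N + i) ^+ 2.
  by apply: sumr_ge0 => i _; exact: sqr_ge0.
rewrite GE.
apply: le_trans (lerD (lerD sJ sH) (lexx _)) _.
move: GJ0 GH0; set GJ := \sum_(i < N) _; set GH := \sum_(i < N) _ => GJ0 GH0.
clear GE sJ sH.
rewrite /pot; set r := sumsq N z in r0 *.
have b2E : b ^+ 2 = 1 - a ^+ 2 by rewrite -ab1; ring.
(* Both terms carry [a^2], so the bound does not degenerate as [a] tends to 0; the square is centred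
   at [2 * N%:R * qbar]. *)
have quart : a ^+ 2 * (beta ^+ 2 * qbar / 2 * r - beta ^+ 2 / (8 * N%:R) * r ^+ 2) <=
   beta ^+ 2 * qbar ^+ 2 * N%:R.
  apply: (@le_trans _ _ (a ^+ 2 * (beta ^+ 2 * qbar ^+ 2 * N%:R))); last first.
    by rewrite ler_piMl//; move: ab1 b0; lra.
  rewrite ler_wpM2l// -subr_ge0.
  rewrite (_ : _ - _ = beta ^+ 2 / (8 * N%:R) * (r - 2 * N%:R * qbar) ^+ 2 +
     beta ^+ 2 * qbar ^+ 2 * N%:R / 2).
    apply: addr_ge0; last by apply: divr_ge0.
    apply: mulr_ge0; last exact: sqr_ge0.
    by apply: divr_ge0; [exact: sqr_ge0|apply: mulr_ge0 => //; exact: ltW].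
  by field; rewrite gt_eqF.
have CJ : GJ <= C * GJ.
  rewrite ler_peMl// /C; have := sqr_ge0 beta; have := normr_ge0 lam.
  by move: bse0 bqq0 bq0 bs0 (ltW beta_gt0); lra.
have CH : bs ^+ 2 / (8 * e) * GH <= C * GH.
  rewrite ler_wpM2r// /C; have := sqr_ge0 beta; have := normr_ge0 lam.
  by move: bse0 bqq0 bq0 bs0 (ltW beta_gt0); lra.
have C1 : beta ^+ 2 * qbar ^+ 2 * N%:R <= C.
  rewrite /C; have := sqr_ge0 beta; have := normr_ge0 lam.
  by move: bse0 bqq0 bq0 bs0 (ltW beta_gt0); lra.
have er : 8 * e * r <= kappa * r by rewrite ler_wpM2r.
rewrite b2E mulrDr mulr1 mulrDr.
have lhsE : beta ^+ 2 * a ^+ 2 / (8 * N%:R) * r ^+ 2 +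
   (- (a ^+ 2 * beta ^+ 2 / (4 * N%:R)) * r ^+ 2 +
   ((1 - a ^+ 2) * - (beta ^+ 2 * qbar) / 2 + lam / 2) * r) =
   a ^+ 2 * (beta ^+ 2 * qbar / 2 * r - beta ^+ 2 / (8 * N%:R) * r ^+ 2) + (1 - kappa) / 2 * r.
  by rewrite /kappa; field; rewrite gt_eqF.
move: lhsE CJ CH C1 er quart.
set X1 := _ * r ^+ 2; set X2 := _ + (_ + _) * r; set X3 := _ * (_ - _ * r ^+ 2).
by lra.
Qed.

Lemma pot_cont a b : seqcont N (pot a b).
Proof.
apply: seqcontD; (apply: seqcontM; first exact: seqcont_cst).
  by apply: seqcontX; exact: seqcont_sumsq.
exact: seqcont_sumsq.
Qed.

Lemma sqr_le1_norm a b : a ^+ 2 + b ^+ 2 = 1 -> `|a| <= 1.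
Proof.
move=> ab1; rewrite -(@expr_le1 _ 2)// real_normK ?num_real//.
by have := sqr_ge0 b; move: ab1; lra.
Qed.

Lemma coef_bound a b k : `|a| <= 1 -> `|b| <= 1 -> `|coef a b k| <= C.
Proof.
move=> a1 b1; have := sqr_ge0 beta; have := normr_ge0 lam; rewrite /coef.
case: ifP => _; rewrite normrM ger0_norm//.
  have : bj * `|a| <= bj by rewrite ler_piMr.
  by rewrite /C; move: bj_le bse0 bqq0 bq0 bs0 (ltW beta_gt0); lra.
have : bs * `|b| <= bs by rewrite ler_piMr.
by rewrite /C; move: bj_le bse0 bqq0 bq0 bs0 (ltW beta_gt0); lra.
Qed.

Lemma quad_le (u v w r : R) : 0 <= r -> `|u| <= v -> `|w| <= C - v ->
  `|u * r ^+ 2 + w * r| <= C * (1 + r) ^+ 2.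
Proof.
move=> r0 uv wC; apply: (le_trans (ler_normD _ _)).
have v0 : 0 <= v := le_trans (normr_ge0 _) uv.
have w0 : 0 <= C - v := le_trans (normr_ge0 _) wC.
rewrite [`|u * _|]normrM [`|w * _|]normrM (ger0_norm r0) (ger0_norm (sqr_ge0 r)).
apply: (@le_trans _ _ (v * (1 + r) ^+ 2 + (C - v) * (1 + r) ^+ 2)); last first.
  by rewrite -mulrDl addrC subrK.
apply: lerD; apply: ler_pM => //; rewrite ?sqr_ge0//.
  by rewrite lerXn2r ?nnegrE ?addr_ge0// lerDr.
by have := sqr_ge0 r; nra.
Qed.

Lemma admissible_rs a b : a ^+ 2 + b ^+ 2 = 1 ->
  admissible M N spin C e (coef a b) (pot a b).
Proof.
move=> ab1; have a0 := sqr_ge0 a; have b0 := sqr_ge0 b.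
split=> [|k kM|z|g z].
- exact: pot_cont.
- apply: coef_bound; first exact: sqr_le1_norm ab1.
  by apply: (@sqr_le1_norm b a); rewrite addrC.
- apply: (@quad_le _ (beta ^+ 2)); first exact: sumsq_ge0.
    rewrite normrN -mulrA ger0_norm; last exact: mulr_ge0.
    apply: (@le_trans _ _ (1 * (beta ^+ 2 / (4 * N%:R)))).
      by rewrite ler_wpM2r//; move: ab1 b0; lra.
    exact: bN_le.
  apply: (le_trans (ler_normD _ _)).
  have -> : b ^+ 2 * - (beta ^+ 2 * qbar) / 2 = - (b ^+ 2 * (beta ^+ 2 * qbar) / 2) by ring.
  rewrite normrN ger0_norm; last by apply: divr_ge0 => //; apply: mulr_ge0.
  rewrite normrM (@ger0_norm _ 2^-1)//.
  have : b ^+ 2 * (beta ^+ 2 * qbar) <= beta ^+ 2 * qbar.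
    by rewrite ler_piMl//; move: ab1 a0; lra.
  rewrite /C; have := normr_ge0 lam.
  by move: bse0 bqq0 bq0 bs0 (ltW beta_gt0); lra.
- exact: ham_ub.
Qed.

(** Written with [2 * sin t * cos t] in front, the angular factor common to all products of a
    coefficient and its derivative. *)
Definition dpot t z : R :=
  (- (2 * sin t * cos t * (beta ^+ 2 / (4 * N%:R)))) * sumsq N z ^+ 2 +
  (2 * sin t * cos t * (beta ^+ 2 * qbar / 2)) * sumsq N z.

Lemma quadratic_dpot t : quadratic N C (dpot t).
Proof.
split.
  apply: seqcontD; (apply: seqcontM; first exact: seqcont_cst).
    by apply: seqcontX; exact: seqcont_sumsq.
  exact: seqcont_sumsq.
move=> z.
have sc : `|2 * sin t * cos t| <= 1.
  have := sqr_ge0 (sin t - cos t); have := sqr_ge0 (sin t + cos t).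
  by have := cos2Dsin2 t; rewrite ler_norml => H1 H2 H3; apply/andP; split; move: H1 H2 H3; nra.
apply: (@quad_le _ (beta ^+ 2)); first exact: sumsq_ge0.
  rewrite normrN normrM (@ger0_norm _ (beta ^+ 2 / _))//.
  apply: (@le_trans _ _ (1 * (beta ^+ 2 / (4 * N%:R)))).
    by rewrite ler_wpM2r.
  exact: bN_le.
rewrite normrM (@ger0_norm _ (beta ^+ 2 * qbar / 2)); last by apply: divr_ge0.
apply: (@le_trans _ _ (1 * (beta ^+ 2 * qbar / 2))).
  by rewrite ler_wpM2r//; apply: divr_ge0.
rewrite /C; have := normr_ge0 lam.
by move: bse0 bqq0 bq0 bs0 (ltW beta_gt0); lra.
Qed.

Lemma is_derive_coef t k : is_derive t 1 (fun u => coef (sin u) (cos u) k)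
  (coef (cos t) (- sin t) k).
Proof.
rewrite /coef; case: ifP => _.
  exact: (is_deriveZ bj (is_derive_sin t)).
exact: (is_deriveZ bs (is_derive_cos t)).
Qed.

Lemma is_derive_pot t z : is_derive t 1 (fun u => pot (sin u) (cos u) z) (dpot t z).
Proof.
set r := sumsq N z.
have -> : (fun u => pot (sin u) (cos u) z) =
    ((- (beta ^+ 2 / (4 * N%:R) * r ^+ 2)) \*: (@sin R ^+ 2)) +
    ((- (beta ^+ 2 * qbar / 2 * r)) \*: (@cos R ^+ 2)) + cst (lam / 2 * r).
  by apply/funext => u; rewrite !fctE /= /GRing.scale /= /pot -/r; ring.
have ds := is_derive_sin t; have dc := is_derive_cos t.
apply: is_derive_eq; rewrite /= /GRing.scale /= !expr1 /dpot -/r; ring.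
Qed.

(** * The interpolated free energy, the overlap fluctuation and the derivative in the angle *)

Definition free_energy a b : R :=
  gexp M (fun g => ln (gpart M N spin (coef a b) (pot a b) g)).

(* The weights turning squared Gibbs averages of spins into the bracket of (q_12 - qbar) ^+ 2, up to qbar ^+ 2. *)
Definition weight k : R := if (k < N * N)%N then N%:R ^- 2 else - (2 * qbar / N%:R).

Lemma weightJ (i j : 'I_N) : weight (i * N + j) = N%:R ^- 2.
Proof. by rewrite /weight idxJ. Qed.

Lemma weightH (i : 'I_N) : weight (N * N + i) = - (2 * qbar / N%:R).
Proof. by rewrite /weight ltnNge leq_addr. Qed.

Definition overlap_var a b g : R :=
  \sum_(k < M) weight k * gavg M N spin (coef a b) (pot a b) (spin k) g ^+ 2 + qbar ^+ 2.

Definition mean_overlap_var a b : R := gexp M (overlap_var a b).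

Lemma gavg_sum a b (m : nat) (f_ : 'I_m -> seq R -> R) (K : 'I_m -> R) g :
  a ^+ 2 + b ^+ 2 = 1 -> (forall i, quadratic N (K i) (f_ i)) ->
  gavg M N spin (coef a b) (pot a b) (fun z => \sum_(i < m) f_ i z) g =
  \sum_(i < m) gavg M N spin (coef a b) (pot a b) (f_ i) g.
Proof.
move=> ab1 qf; have ad := admissible_rs ab1.
have e4 : 1 / 2 - e < 1 / 2 by rewrite ltrBlDr ltrDl.
rewrite /gavg -mulr_suml; congr (_ / _); rewrite /gint -(gexp_sum e4).
- by congr gexp; apply/funext => z; rewrite mulr_suml.
- by move: e8; lra.
- by move=> i; exact: (gibbs_gadm e0 spin_cont g ad (qf i)).
Qed.

Lemma gavgZ a b y (f : seq R -> R) K g : a ^+ 2 + b ^+ 2 = 1 -> quadratic N K f ->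
  gavg M N spin (coef a b) (pot a b) (fun z => y * f z) g =
  y * gavg M N spin (coef a b) (pot a b) f g.
Proof.
move=> ab1 qf; have ad := admissible_rs ab1.
have e4 : 1 / 2 - e < 1 / 2 by rewrite ltrBlDr ltrDl.
rewrite /gavg mulrA; congr (_ / _); rewrite /gint -(gexpZ e4).
  by congr gexp; apply/funext => z; rewrite mulrA.
exact: (gibbs_gadm e0 spin_cont g ad qf).
Qed.

Lemma quadratic_spin k : (k < M)%N -> quadratic N 1 (spin k).
Proof. by move=> kM; exact: (quadratic_phi spin_cont spin_bound kM). Qed.

Lemma quadratic_spin2 k : (k < M)%N -> quadratic N 1 (fun z => spin k z ^+ 2).
Proof. by move=> kM; exact: (quadratic_phi2 spin_cont spin_bound kM). Qed.

Let q4 : 1 / 4 < 1 / 2 :> R. Proof. lra. Qed.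
Let q0 : 0 <= 1 / 4 :> R. Proof. lra. Qed.

Section FixedParameters.
Variables a b : R.
Hypothesis ab1 : a ^+ 2 + b ^+ 2 = 1.
Let ad := admissible_rs ab1.
Local Notation avg := (gavg M N spin (coef a b) (pot a b)).

Lemma gadm_spin_sqr (k : 'I_M) : gadm M (1 / 4) (fun g => avg (spin k) g ^+ 2).
Proof. exact: (gadm_gavg_sqr e0 e8 C0 spin_cont spin_bound ad (quadratic_spin (ltn_ord k))). Qed.

Lemma gadm_spin2 (k : 'I_M) : gadm M (1 / 4) (avg (fun z => spin k z ^+ 2)).
Proof. exact: (gadm_gavg e0 e8 C0 spin_cont spin_bound ad (quadratic_spin2 (ltn_ord k))). Qed.

Lemma mean_overlap_varE : mean_overlap_var a b =
  \sum_(k < M) weight k * gexp M (fun g => avg (spin k) g ^+ 2) + qbar ^+ 2.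
Proof.
have gk (k : 'I_M) := gadmZ (weight k) (gadm_spin_sqr k).
rewrite /mean_overlap_var /overlap_var (gexpD q4); last exact: gadm_cst.
  rewrite gexp_cst (gexp_sum q4)//; congr (_ + _); apply: eq_bigr => k _.
  by rewrite (gexpZ q4)//; exact: gadm_spin_sqr.
exact: gadm_sum.
Qed.

(** Expanding the square gives [N^-2] times the sum of [z1_i z1_j z2_i z2_j], minus [2 qbar / N]
    times the sum of [z1_i z2_i], plus [qbar^2]. Each term is a product of one function per replica,
    and both replicas see the same disorder, whence squares of one-replica averages. *)
Lemma overlap_var_gibbs g :
  let w z := expR (ham M spin (coef a b) (pot a b) g z) in
  gexp N (fun z1 => gexp N (fun z2 => (overlap N z1 z2 - qbar) ^+ 2 * w z1 * w z2)) /
    (gexp N w) ^+ 2 = overlap_var a b g.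
Proof.
move=> w; have e4 : 1 / 2 - e < 1 / 2 by rewrite ltrBlDr ltrDl.
have e5 : 0 <= 1 / 2 - e by move: e8; lra.
pose A (k : 'I_M) := gint M N spin (coef a b) (pot a b) (spin k) g.
have ZE : gexp N w = gpart M N spin (coef a b) (pot a b) g.
  by congr gexp; apply/funext => z; rewrite mul1r.
have Z0 : gexp N w != 0.
  by rewrite ZE gt_eqF// (gpart_gt0 e0 e8 C0 spin_cont spin_bound g ad).
have gw : gadm N (1 / 2 - e) w.
  have := gibbs_gadm e0 spin_cont g ad (quadratic_cst N 1).
  by under eq_fun do rewrite mul1r.
have gs (k : 'I_M) : gadm N (1 / 2 - e) (fun z => spin k z * w z).
  exact: (gibbs_gadm e0 spin_cont g ad (quadratic_spin (ltn_ord k))).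
have F z1 z2 : (overlap N z1 z2 - qbar) ^+ 2 * w z1 * w z2 =
   \sum_(k < M) (weight k * (spin k z1 * w z1)) * (spin k z2 * w z2) + (qbar ^+ 2 * w z1) * w z2.
  rewrite (sum_disorder (fun k => (weight k * (spin k z1 * w z1)) * (spin k z2 * w z2))).
  pose S := \sum_(i < N) zc z1 i * zc z2 i.
  rewrite (_ : \sum_(i < N) \sum_(j < N) _ = N%:R ^- 2 * S ^+ 2 * (w z1 * w z2)); last first.
    rewrite [S ^+ 2]expr2 /S big_distrlr mulr_sumr mulr_suml; apply: eq_bigr => i _.
    rewrite mulr_sumr mulr_suml; apply: eq_bigr => j _.
    by rewrite !spinJ weightJ /=; ring.
  rewrite (_ : \sum_(i < N) _ = - (2 * qbar / N%:R) * S * (w z1 * w z2)); last first.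
    rewrite mulr_sumr mulr_suml; apply: eq_bigr => i _.
    by rewrite !spinH weightH; ring.
  by rewrite /overlap -/S; field; rewrite gt_eqF.
have inner z1 : gexp N (fun z2 => (overlap N z1 z2 - qbar) ^+ 2 * w z1 * w z2) =
   \sum_(k < M) (weight k * A k) * (spin k z1 * w z1) + (qbar ^+ 2 * gexp N w) * w z1.
  under eq_fun do rewrite F.
  rewrite (gexpD e4); [|by apply: gadm_sum => // k; exact: gadmZ|exact: gadmZ].
  rewrite (gexp_sum e4)//; last by move=> k; exact: gadmZ.
  rewrite (gexpZ e4)//; congr (_ + _); last by ring.
  apply: eq_bigr => k _; rewrite (gexpZ e4)//.
  by rewrite -/(gint M N spin (coef a b) (pot a b) (spin k) g) -/(A k); ring.
under eq_fun do rewrite inner.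
rewrite (gexpD e4); [|by apply: gadm_sum => // k; exact: gadmZ|exact: gadmZ].
rewrite (gexp_sum e4)//; last by move=> k; exact: gadmZ.
rewrite (gexpZ e4)// mulrDl /overlap_var mulr_suml; congr (_ + _); last by field.
apply: eq_bigr => k _; rewrite (gexpZ e4)//.
rewrite -/(gint M N spin (coef a b) (pot a b) (spin k) g) /gavg -ZE -/(A k).
by field.
Qed.

End FixedParameters.

Lemma free_energy_derive t :
  is_derive t 1 (fun u => free_energy (sin u) (cos u))
    (2 * sin t * cos t * (N%:R * beta ^+ 2 / 4 *
      (qbar ^+ 2 - mean_overlap_var (sin t) (cos t)))).
Proof.
have sc u : sin u ^+ 2 + cos u ^+ 2 = 1 :> R by rewrite addrC cos2Dsin2.
have sc1 u : `|@sin R u| <= 1 by exact: sqr_le1_norm (sc u).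
have cs1 u : `|@cos R u| <= 1.
  by apply: (@sqr_le1_norm (cos u) (sin u)); rewrite addrC.
have adt u := admissible_rs (sc u).
have := @gexp_ln_gpart_derive R M N spin C e e0 e8 C0 spin_cont spin_bound
  (fun u => coef (sin u) (cos u)) (fun u => coef (cos u) (- sin u))
  (fun u => pot (sin u) (cos u)) dpot adt _ quadratic_dpot
  (fun u k _ => is_derive_coef u k) is_derive_pot t.
move=> /(_ (fun u k _ => coef_bound k (cs1 u) _)) H.
apply: is_derive_eq; first by apply: H => *; rewrite normrN.
set X := 2 * sin t * cos t; set avg := gavg _ _ _ _ _.
pose Y := X * (N%:R * beta ^+ 2 / 4).
(* Up to the common factor [Y], the products of coefficients and derivatives are the expansion
   coefficients of the squared overlap deviation; the negative sign on the fields comes from the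
   derivative of [cos]. *)
have ccE k : coef (sin t) (cos t) k * coef (cos t) (- sin t) k = Y * weight k.
  rewrite /Y /X /coef /weight; case: ifP => _.
    rewrite mulrACA -expr2 bj2; field; by rewrite gt_eqF.
  rewrite mulrACA -expr2 bs2; field; by rewrite gt_eqF.
(* The same weights with opposite sign: this is the cancellation of the one-replica terms. *)
have dpotE : dpot t = fun z => \sum_(k < M) - (Y * weight k) * spin k z ^+ 2.
  apply/funext => z; rewrite (sum_disorder (fun k => - (Y * weight k) * spin k z ^+ 2)).
  rewrite /dpot -/X sumsq_sqr mulr_sumr; congr (_ + _).
    apply: eq_bigr => i _; rewrite mulr_sumr; apply: eq_bigr => j _.
    by rewrite weightJ spinJ /Y; field; rewrite gt_eqF.
  rewrite /sumsq mulr_sumr; apply: eq_bigr => i _.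
  by rewrite weightH spinH /Y; field; rewrite gt_eqF.
have W g : avg (dpot t) g = \sum_(k < M) - (Y * weight k) * avg (fun z => spin k z ^+ 2) g.
  have qk (k : 'I_M) := quadraticZ (- (Y * weight k)) (quadratic_spin2 (ltn_ord k)).
  rewrite dpotE; apply: (etrans (gavg_sum g (sc t) qk)); apply: eq_bigr => k _.
  exact: gavgZ (sc t) (quadratic_spin2 (ltn_ord k)).
have g2 (k : 'I_M) := gadm_spin2 (sc t) k.
have gs (k : 'I_M) := gadm_spin_sqr (sc t) k.
rewrite (_ : gexp M (avg (dpot t)) = gexp M (fun g =>
  \sum_(k < M) - (Y * weight k) * avg (fun z => spin k z ^+ 2) g)); last first.
  by congr gexp; apply/funext => g; exact: W.
rewrite (gexp_sum q4)//; last by move=> k; exact: gadmZ.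
rewrite mean_overlap_varE// -big_split opprD addrCA subrr addr0 mulrA -/Y.
rewrite mulrN mulr_sumr -sumrN; apply: eq_bigr => k _ /=.
by rewrite (gexpZ q4)// (gexpB q4)// ccE; ring.
Qed.

(** * Identification with the model, and the two endpoints *)

Lemma wtE t J J' z : 0 <= t <= 1 -> size J = (N * N)%N ->
  wt N beta lam qbar t J J' z = expR (ham M spin (coef (Num.sqrt t) (Num.sqrt (1 - t)))
    (pot (Num.sqrt t) (Num.sqrt (1 - t))) (J ++ J') z).
Proof.
move=> /andP[t0 t1] sJ; rewrite /wt /ham; congr expR.
rewrite (sum_disorder (fun k => coef _ _ k * zc (J ++ J') k * spin k z)).
have -> : \sum_(i < N) \sum_(j < N) coef (Num.sqrt t) (Num.sqrt (1 - t)) (i * N + j) *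
    zc (J ++ J') (i * N + j) * spin (i * N + j) z = bj * Num.sqrt t * Hquad N J z.
  rewrite /Hquad mulr_sumr; apply: eq_bigr => i _; rewrite mulr_sumr; apply: eq_bigr => j _.
  by rewrite coefJ spinJ /Jc /zc nth_cat sJ idxJ -!mulrA.
have -> : \sum_(i < N) coef (Num.sqrt t) (Num.sqrt (1 - t)) (N * N + i) *
    zc (J ++ J') (N * N + i) * spin (N * N + i) z =
    bs * Num.sqrt (1 - t) * \sum_(i < N) zc J' i * zc z i.
  rewrite mulr_sumr; apply: eq_bigr => i _.
  by rewrite coefH spinH /zc nth_cat sJ ltnNge leq_addr /= addKn -!mulrA.
rewrite /pot !sqr_sqrtr ?subr_ge0// sqrtrM// sqrtrV ?mulr_ge0//.
rewrite /bj /bs; ring.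
Qed.

Lemma bracketE t : 0 <= t <= 1 ->
  bracket N beta lam qbar t (fun z1 z2 => (overlap N z1 z2 - qbar) ^+ 2) =
  mean_overlap_var (Num.sqrt t) (Num.sqrt (1 - t)).
Proof.
move=> t01; have /andP[t0 t1] := t01.
(* [gexp_eq] compares integrands only on lists of the exact length; knowing [size J] is what makes
   index [N * N + i] of [J ++ J'] point to the field [i]. *)
rewrite /bracket /mean_overlap_var gexp_cat; apply: gexp_eq => J sJ.
apply: gexp_eq => J' _.
rewrite -overlap_var_gibbs; last by rewrite !sqr_sqrtr ?subr_ge0// addrC subrK.
rewrite /gibbs2; congr (_ / _ ^+ 2); last by apply: gexp_eq => z _; rewrite wtE.
by apply: gexp_eq => z1 _; apply: gexp_eq => z2 _; rewrite !wtE.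
Qed.

Lemma ANE : AN N beta lam = N%:R^-1 * free_energy 1 0.
Proof.
rewrite /AN /free_energy gexp_cat; congr (_ * _); apply: gexp_eq => J sJ.
(* At [a = 1], [b = 0] the fields decouple, so an integral over [J'] can be inserted around a
   constant. *)
rewrite -[LHS](gexp_cst N); apply: gexp_eq => J' _; congr ln.
rewrite /ZN /gpart /gint; apply: gexp_eq => z _; rewrite mul1r; congr expR.
rewrite /ham (sum_disorder (fun k => coef _ _ k * zc (J ++ J') k * spin k z)).
have -> : \sum_(i < N) \sum_(j < N) coef 1 0 (i * N + j) *
    zc (J ++ J') (i * N + j) * spin (i * N + j) z = bj * Hquad N J z.
  rewrite /Hquad mulr_sumr; apply: eq_bigr => i _; rewrite mulr_sumr; apply: eq_bigr => j _.
  by rewrite coefJ spinJ /Jc /zc nth_cat sJ idxJ -!mulrA mul1r.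
rewrite big1 => [|i _]; last by rewrite coefH mulr0 !mul0r.
by rewrite /pot /bj; ring.
Qed.

(** Couplings and quartic term vanish, leaving a product of one-dimensional Gaussian integrals of
    variance [1 / kappa]; its logarithm is quadratic in the fields, so only their second moments
    enter. *)
Lemma free_energy01 : free_energy 0 1 =
  N%:R * (ln (sigmaRS beta lam qbar) + 1 / 2 * beta ^+ 2 * qbar * sigmaRS beta lam qbar ^+ 2).
Proof.
set v := sigmaRS _ _ _.
have v0 : 0 < v by rewrite invr_gt0 sqrtr_gt0.
have Z g : gpart M N spin (coef 0 1) (pot 0 1) g =
    v ^+ N * expR (v ^+ 2 / 2 * \sum_(i < N) (bs * zc g (N * N + i)) ^+ 2).
  (* With this exponent [1 - 2 d = kappa], and the standard deviation in [gexp_expR] becomes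
     [sigmaRS]. *)
  have d2 : (1 - kappa) / 2 < 1 / 2 by move: (kappa_gt0); rewrite -/kappa; lra.
  have := @gexp_expR R N (fun i => bs * zc g (N * N + i)) _ d2.
  rewrite (_ : 1 - 2 * ((1 - kappa) / 2) = kappa); last by field.
  rewrite -/(sigmaRS beta lam qbar) -/v => <-; apply: gexp_eq => z _; rewrite mul1r; congr expR.
  rewrite /ham (sum_disorder (fun k => coef _ _ k * zc g k * spin k z)).
  rewrite big1 ?add0r => [|i _]; last first.
    by apply: big1 => j _; rewrite coefJ mulr0 !mul0r.
  congr (_ + _); last by rewrite /pot /kappa; field; rewrite gt_eqF.
  by apply: eq_bigr => i _; rewrite coefH spinH mulr1.
have lnZ g : ln (gpart M N spin (coef 0 1) (pot 0 1) g) =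
    N%:R * ln v + \sum_(i < N) v ^+ 2 / 2 * (beta ^+ 2 * qbar) * (zc g (N * N + i) * zc g (N * N + i)).
  rewrite Z lnM ?posrE ?exprn_gt0 ?expR_gt0// lnXn// expRK mulr_natl; congr (_ + _).
  by rewrite mulr_sumr; apply: eq_bigr => i _; rewrite exprMn bs2; ring.
have zk (i : 'I_N) : (N * N + i < M)%N by rewrite ltn_add2l.
have g1 (i : 'I_N) : gadm M (1 / 4) (fun g : seq R => zc g (N * N + i)).
  apply: (@poly_gadm R M 1 1) => //; first exact: seqcont_zc.
  by move=> g; rewrite expr1 mul1r; exact: norm_zc_le.
have g2 (i : 'I_N) : gadm M (1 / 4) (fun g : seq R => zc g (N * N + i) * zc g (N * N + i)).
  apply: (@poly_gadm R M 2 1) => //; first by apply: seqcontM; exact: seqcont_zc.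
  by move=> g; rewrite normrM mul1r expr2; apply: ler_pM => //; exact: norm_zc_le.
(* The second moment is obtained by integrating the coordinate function by parts. *)
have E2 (i : 'I_N) : gexp M (fun g : seq R => zc g (N * N + i) * zc g (N * N + i)) = 1.
  have gc : gadm M (1 / 4) (fun=> 1 : R) by exact: gadm_cst.
  have H (s : seq R) y : is_derive y 1 (fun y => zc (set_nth 0 s (N * N + i) y) (N * N + i)) 1.
    rewrite /zc; under eq_fun do rewrite nth_set_nth /= eqxx.
    exact: is_derive_id.
  by rewrite (gexp_ibp q4 (zk i) (g1 i) gc H) gexp_cst.
rewrite /free_energy; under eq_fun do rewrite lnZ.
rewrite (gexpD q4); [|exact: gadm_cst|by apply: gadm_sum => // i; exact: gadmZ].
rewrite gexp_cst (gexp_sum q4)//; last by move=> i; exact: gadmZ.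
under eq_bigr do rewrite (gexpZ q4)// E2 mulr1.
by rewrite sumr_const card_ord -[in LHS]mulr_natl; field.
Qed.

(** * Return from the angle to [t]: continuity up to the endpoints and integration *)

Lemma cvg_coef (a_ b_ : nat -> R) a b k : a_ m @[m --> \oo] --> a ->
  b_ m @[m --> \oo] --> b -> coef (a_ m) (b_ m) k @[m --> \oo] --> coef a b k.
Proof.
by move=> aa bb; rewrite /coef; case: ifP => _; apply: cvg_seqM => //; exact: cvg_cst.
Qed.

Lemma cvg_pot (a_ b_ : nat -> R) a b z : a_ m @[m --> \oo] --> a ->
  b_ m @[m --> \oo] --> b -> pot (a_ m) (b_ m) z @[m --> \oo] --> pot a b z.
Proof.
move=> aa bb; apply: cvg_seqD; apply: cvg_seqM; try exact: cvg_cst.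
  apply: cvg_seqN; apply: cvg_seqM; last exact: cvg_cst.
  by apply: cvg_seqM; [exact: cvg_seqX|exact: cvg_cst].
apply: cvg_seqD; last exact: cvg_cst.
apply: cvg_seqM; last exact: cvg_cst.
by apply: cvg_seqM; [exact: cvg_seqX|exact: cvg_cst].
Qed.

(** Restricted to the unit circle, where [admissible_rs] provides the uniform bounds. *)
Definition circle_continuous (F : R -> R -> R) := forall (a_ b_ : nat -> R) a b,
  (forall m, a_ m ^+ 2 + b_ m ^+ 2 = 1) -> a ^+ 2 + b ^+ 2 = 1 ->
  a_ m @[m --> \oo] --> a -> b_ m @[m --> \oo] --> b ->
  F (a_ m) (b_ m) @[m --> \oo] --> F a b.

Lemma circle_continuous_free_energy : circle_continuous free_energy.
Proof.
move=> a_ b_ a b ab_ ab aa bb.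
apply: (cvg_gexp_ln_gpart e0 e8 C0 spin_cont spin_bound
  (fun m => admissible_rs (ab_ m)) (admissible_rs ab)) => [k _|z].
  exact: cvg_coef.
exact: cvg_pot.
Qed.

Lemma circle_continuous_mean_overlap_var : circle_continuous mean_overlap_var.
Proof.
move=> a_ b_ a b ab_ ab aa bb; rewrite (mean_overlap_varE ab).
under eq_fun do rewrite (mean_overlap_varE (ab_ _)).
apply: cvg_seqD; last exact: cvg_cst.
apply: cvg_seq_sum => k; apply: cvg_seqM; first exact: cvg_cst.
apply: (cvg_gexp_gavg_sqr e0 e8 C0 spin_cont spin_bound
  (fun m => admissible_rs (ab_ m)) (admissible_rs ab) (ltn_ord k)) => [i _|z].
  exact: cvg_coef.
exact: cvg_pot.
Qed.

(* Projection of the line onto [0, 1]; it makes the interpolation continuous on R. *)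
Definition clip t : R := (`|t| - `|t - 1| + 1) / 2.

Lemma clip_id t : 0 <= t <= 1 -> clip t = t.
Proof.
by move=> /andP[t0 t1]; rewrite /clip ger0_norm// ler0_norm ?subr_le0//; lra.
Qed.

Lemma clip_itv t : 0 <= clip t <= 1.
Proof.
have := ler_normD (t - 1) 1; have := ler_normB t 1; rewrite subrK normr1 /clip => H1 H2.
have := ler_normD t (1 - t); rewrite addrCA subrr addr0 normr1 distrC => H3.
by apply/andP; split; lra.
Qed.

Definition on_path (F : R -> R -> R) t := F (Num.sqrt (clip t)) (Num.sqrt (1 - clip t)).

Lemma on_pathE F t : 0 <= t <= 1 -> on_path F t = F (Num.sqrt t) (Num.sqrt (1 - t)).
Proof. by move=> t01; rewrite /on_path clip_id. Qed.

Lemma continuous_on_path F : circle_continuous F -> continuous (on_path F).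
Proof.
move=> cF t; apply/(@cvg_nbhsP _ R^o) => u ut.
have cc : clip (u m) @[m --> \oo] --> clip t.
  apply: cvg_seqM; last exact: cvg_cst.
  apply: cvg_seqD; last exact: cvg_cst.
  apply: cvg_seqD; first exact: cvg_norm.
  apply: cvg_seqN; apply: cvg_norm.
  by apply: cvg_seqD => //; exact: cvg_cst.
have circ y : Num.sqrt (clip y) ^+ 2 + Num.sqrt (1 - clip y) ^+ 2 = 1.
  have /andP[y0 y1] := clip_itv y.
  by rewrite !sqr_sqrtr ?subr_ge0// addrC subrK.
apply: cF => //.
- by apply: (cvg_comp _ (@Num.sqrt R) cc); exact: sqrt_continuous.
- apply: (cvg_comp (fun m => 1 - clip (u m)) (@Num.sqrt R)); last exact: sqrt_continuous.
  by apply: cvg_seqD; [exact: cvg_cst|exact: cvg_seqN].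
Qed.

(** For [theta = asin (sqrt t)] the chain rule contributes [1 / (2 sqrt t sqrt (1 - t))], which
    cancels the factor [2 sin theta cos theta] of [free_energy_derive]. This change of variable is
    differentiable only inside the interval. *)
Lemma is_derive_on_path t : 0 < t < 1 -> is_derive t 1 (on_path free_energy)
  (N%:R * beta ^+ 2 / 4 * (qbar ^+ 2 - on_path mean_overlap_var t)).
Proof.
move=> /andP[t0 t1].
have st (u : R) : 0 < u < 1 -> 0 < Num.sqrt u < 1.
  move=> /andP[u0 u1]; rewrite sqrtr_gt0 u0 /= -[ltRHS]sqrtr1 ltr_sqrt//.
have /andP[s0 s1] : 0 < Num.sqrt t < 1 by apply: st; rewrite t0.
have sinE (u : R) : 0 < u < 1 -> sin (asin (Num.sqrt u)) = Num.sqrt u.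
  by move=> u01; have /andP[u0 u1] := st _ u01; rewrite asinK// in_itv /=; lra.
have cosE (u : R) : 0 < u < 1 -> cos (asin (Num.sqrt u)) = Num.sqrt (1 - u).
  move=> u01; have /andP[u0 u1] := st _ u01; rewrite cos_asin; last lra.
  by rewrite sqr_sqrtr//; move: u01 => /andP[/ltW].
(* The identity with the angular form holds only on []0, 1[], so derivatives are transported through
   equality near [t]. *)
have near_eq : \near t, (free_energy (sin (asin (Num.sqrt t))) (cos (asin (Num.sqrt t)))) = on_path free_energy t.
  have : t \in `]0, 1[ by rewrite in_itv /= t0.
  move=> /near_in_itvoo; apply: filterS => u; rewrite in_itv /= => u01.
  rewrite sinE// cosE// on_pathE//; move: u01 => /andP[? ?]; lra.
apply: (near_eq_is_derive near_eq).
have d1 := is_derive1_sqrt t0.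
have d2 : is_derive (Num.sqrt t) 1 (@asin R) (Num.sqrt (1 - Num.sqrt t ^+ 2))^-1.
  by apply: is_derive1_asin; lra.
have d3 := @is_derive1_comp _ (@asin R) (@Num.sqrt R) t _ _ d2 d1.
have d4 := free_energy_derive (asin (Num.sqrt t)).
have := @is_derive1_comp _ (fun u => free_energy (sin u) (cos u)) (@asin R \o @Num.sqrt R) t _ _ d4 d3.
move=> H; refine (is_derive_eq H _).
have t01 : 0 < t < 1 by rewrite t0.
rewrite sinE// cosE// sqr_sqrtr ?(ltW t0)// on_pathE; last lra.
have s2 : 0 < Num.sqrt (1 - t) by rewrite sqrtr_gt0 subr_gt0.
by field; rewrite !gt_eqF.
Qed.

(** Fundamental theorem of calculus for [on_path free_energy]: differentiable inside, continuous at
    both ends, with a derivative that extends continuously to the line thanks to [clip]. *)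
Lemma free_energy_interpolation : free_energy 1 0 - free_energy 0 1 =
  N%:R * beta ^+ 2 / 4 * (qbar ^+ 2 -
    \int[@lebesgue_measure R]_(t in `[0, 1])
       bracket N beta lam qbar t (fun z1 z2 => (overlap N z1 z2 - qbar) ^+ 2)).
Proof.
have cm := continuous_on_path circle_continuous_mean_overlap_var.
have cf := continuous_on_path circle_continuous_free_energy.
set k := N%:R * beta ^+ 2 / 4.
have cm' : continuous (fun t => k * (qbar ^+ 2 - on_path mean_overlap_var t)).
  move=> t; apply: cvgM; first exact: cvg_cst.
  by apply: cvgB; [exact: cvg_cst|exact: cm].
have FTC : (\int[@lebesgue_measure R]_(t in `[0%R, 1%R]) (k * (qbar ^+ 2 - on_path mean_overlap_var t))%:E =
    (on_path free_energy 1)%:E - (on_path free_energy 0)%:E)%E.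
  apply: continuous_FTC2 => //.
  - exact: continuous_subspaceT.
  - split=> [t||].
    + by rewrite in_itv /= => t01; case: (is_derive_on_path t01).
    + exact/cvg_at_right_filter/cf.
    + exact/cvg_at_left_filter/cf.
  - move=> t; rewrite in_itv /= => t01; rewrite derive1E.
    by have [_] := is_derive_on_path t01.
have im : (@lebesgue_measure R).-integrable `[0, 1] (EFin \o on_path mean_overlap_var).
  apply: continuous_compact_integrable; first exact: segment_compact.
  exact: continuous_subspaceT.
have ic (c : R) : (@lebesgue_measure R).-integrable `[0, 1] (EFin \o cst c).
  apply: continuous_compact_integrable; first exact: segment_compact.
  by apply: continuous_subspaceT => t; exact: cvg_cst.
have -> : free_energy 1 0 - free_energy 0 1 =
    \int[@lebesgue_measure R]_(t in `[0, 1]) (k * (qbar ^+ 2 - on_path mean_overlap_var t)).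
  rewrite /Rintegral FTC !on_pathE ?lexx ?ler01//=.
  by rewrite sqrtr0 subrr subr0 sqrtr1 sqrtr0.
rewrite RintegralZl//; last first.
  rewrite (_ : _ \o _ = (fun t => (EFin \o cst (qbar ^+ 2)%R) t - (EFin \o on_path mean_overlap_var) t)%E).
    exact: integrableB.
  by apply/funext => t /=; rewrite EFinB.
rewrite RintegralB//; last exact: ic.
congr (_ * (_ - _)).
  have := @lebesgue_measure_itv R `[0%R, 1%R]; rewrite /= lte01 oppr0 adde0 => m1.
  rewrite Rintegral_cst// -[RHS]mulr1; congr (_ * _).
  exact: (congr1 fine m1).
by apply: eq_Rintegral => t; rewrite inE /= in_itv /= => t01; rewrite bracketE// on_pathE.
Qed.

End ReplicaSymmetric.

(** Gives the sign of the remainder. Positivity passes through the iterated integrals pointwise,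
    without any integrability condition on [F]. *)
Lemma bracket_ge0 (R : realType) N (beta lam qbar t : R) (F : seq R -> seq R -> R) :
  (forall z1 z2, 0 <= F z1 z2) -> 0 <= bracket N beta lam qbar t F.
Proof.
move=> F0; apply: gexp_ge0 => J; apply: gexp_ge0 => J'.
rewrite divr_ge0 ?sqr_ge0//; apply: gexp_ge0 => z1; apply: gexp_ge0 => z2.
by rewrite !mulr_ge0 ?expR_ge0.
Qed.

Unset Implicit Arguments.

Theorem mainTheorem8 (R : realType) (beta lam qbar : R) :
  0 < beta -> inD beta lam qbar ->
  forall N : nat, (1 <= N)%N ->
    AN N beta lam = Atilde beta lam qbar
      - beta ^+ 2 / 4 *
        (\int[@lebesgue_measure R]_(t in `[0, 1]%classic)
           bracket N beta lam qbar t (fun z1 z2 => (overlap N z1 z2 - qbar) ^+ 2))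
    /\ AN N beta lam <= Atilde beta lam qbar.
Proof.
move=> beta0 [q0 k0] N N0.
set I := \int[_]_(t in _) _.
have E : AN N beta lam = Atilde beta lam qbar - beta ^+ 2 / 4 * I.
  have H := free_energy_interpolation beta0 q0 k0 N0.
  rewrite (ANE beta lam qbar N0) -[free_energy _ _ _ _ 1 0](subrK (free_energy beta lam qbar N 0 1)).
  rewrite H (free_energy01 q0 k0 N0) -/I /Atilde.
  by field; rewrite pnatr_eq0 -lt0n.
split=> //; rewrite E gerBl mulr_ge0 ?divr_ge0 ?sqr_ge0//.
by apply: Rintegral_ge0 => t _; apply: bracket_ge0 => z1 z2; exact: sqr_ge0.
Qed.
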